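(* For every partition $\lambda$, \[ G_\lambda(\mathbf x;\boldsymbol\alpha,\boldsymbol\beta)=\sum_{T\in\mathrm{MMSVT}(\lambda)}\mathrm{wt}(T). \]
   Context: Parameters $\boldsymbol\alpha=(\alpha_1,\dots)$, $\boldsymbol\beta=(\beta_1,\dots)$, variables $\mathbf x=(x_1,x_2,\dots)$. For a partition $\lambda$ with at most $n$ parts let $G_\lambda(x_1,\dots,x_n;\boldsymbol\alpha,\boldsymbol\beta)=\det\big(x_j^{\lambda_i+n-i}\prod_{k=1}^{i-1}(1-\beta_kx_j)/\prod_{k=1}^{\lambda_i}(1-\alpha_kx_j)\big)_{i,j=1}^n/\prod_{1\le i<j\le n}(x_i-x_j)$, and let $G_\lambda(\mathbf x;\boldsymbol\alpha,\boldsymbol\beta)$ be the unique formal power series whose specialization $x_{n+1}=x_{n+2}=\dots=0$ is $G_\lambda(x_1,\dots,x_n;\boldsymbol\alpha,\boldsymbol\beta)$ for all $n\ge\ell(\lambda)$. A marked multiset-valued tableau of (skew) shape $\lambda/\mu$ is a filling $T$ of each cell $(i,j)$ (row $i$, column $j$) with a nonempty multiset $T(i,j)=\{a_1\le\dots\le a_k\}$ of positive integers, where each $a_t$ with $t\ge2$ and $a_{t-1}<a_t$ may be marked, such that $\max T(i,j)\le\min T(i,j+1)$ and $\max T(i,j)<\min T(i+1,j)$ whenever the respective cells lie in the shape. $\mathrm{MMSVT}(\lambda/\mu)$ is the set of these ($\lambda=\lambda/\emptyset$). Its weight is $\mathrm{wt}(T)=\prod_{(i,j)}\mathbf x^{T(i,j)}\alpha_j^{u(T(i,j))-1}(-\beta_i)^{m(T(i,j))}$,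 where $\mathbf x^{T(i,j)}=\prod_k x_k^{(\text{multiplicity of }k\text{, marked or not, in }T(i,j))}$, and $u$, $m$ count unmarked and marked elements respectively. *)

(* Defs.v *)
From HB Require Import structures.
From mathcomp Require Import all_boot all_order all_algebra.
From mathcomp Require Import finmap multiset.
From mathcomp Require Import boolp classical_sets functions cardinality fsbigop.

Set Implicit Arguments.
Unset Strict Implicit.
Unset Printing Implicit Defensive.

Import GRing.Theory.
Local Open Scope ring_scope.
Local Open Scope mset_scope.

Definition submsets (m : {mset nat}) : seq {mset nat} :=
  undup [seq seq_mset (mask (val b) m) | b <- enum {: (size m).-tuple bool}].

Lemma submsets_uniq (m : {mset nat}) : uniq (submsets m).
Proof. exact: undup_uniq. Qed.

Lemma mem_submsets (m d : {mset nat}) : (d \in submsets m) = (d `<=` m).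
Proof.
rewrite mem_undup; apply/mapP/msubsetP => [[b _ ->] x|dm].
  rewrite mset_seqE -[leqRHS]count_mem_mset; apply: leq_count_subseq.
  exact: mask_subseq.
have /count_subseqP[s sm ds] : forall x : nat, (count_mem x d <= count_mem x m)%N.
  by move=> x; rewrite !count_mem_mset.
case/subseqP: sm => b sb sE.
exists (Tuple (introT eqP sb)); first by rewrite mem_enum.
rewrite /= -sE -[LHS]seq_mset_id; exact/eq_seq_msetP.
Qed.

Record fps (R : comNzRingType) := Fps { coef : {mset nat} -> R }.
Coercion coef : fps >-> Funclass.

HB.lock Definition fpsC (R : comNzRingType) (c : R) : fps R :=
  Fps (fun m => if m == mset0 then c else 0).
Arguments fpsC {R} c.

HB.lock Definition fpsX (R : comNzRingType) (i : nat) : fps R :=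
  Fps (fun m => (m == [mset i])%:R).

HB.lock Definition fps_mul (R : comNzRingType) (f g : fps R) : fps R :=
  Fps (fun m => \sum_(d <- submsets m) f d * g (m `\` d)).
Arguments fps_mul {R} f g.

Section FpsRing.
Variable R : comNzRingType.
HB.instance Definition _ := [isNew for @coef R].
HB.instance Definition _ := [Choice of fps R by <:].
Implicit Types f g h : fps R.

Lemma fpsP f g : (forall m, f m = g m) <-> f = g.
Proof.
by split=> [|->//]; case: f g => f [g] /= fg; congr Fps; apply/funext.
Qed.

Definition fps_zero : fps R := Fps (fun=> 0).
Definition fps_add f g := Fps (fun m => f m + g m).
Definition fps_opp f := Fps (fun m => - f m).

Lemma fpsCE c m : fpsC c m = if m == mset0 then c else 0 :> R.
Proof. by rewrite unlock. Qed.
Lemma fpsXE i m : fpsX R i m = (m == [mset i])%:R.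
Proof. by rewrite unlock. Qed.

Fact fps_addA : associative fps_add.
Proof. by move=> f g h; apply/fpsP => m /=; rewrite addrA. Qed.
Fact fps_addC : commutative fps_add.
Proof. by move=> f g; apply/fpsP => m /=; rewrite addrC. Qed.
Fact fps_add0 : left_id fps_zero fps_add.
Proof. by move=> f; apply/fpsP => m /=; rewrite add0r. Qed.
Fact fps_addN : left_inverse fps_zero fps_opp fps_add.
Proof. by move=> f; apply/fpsP => m /=; rewrite addNr. Qed.
HB.instance Definition _ :=
  GRing.isZmodule.Build (fps R) fps_addA fps_addC fps_add0 fps_addN.

Lemma msetDB (a m : {mset nat}) : a `<=` m -> a `+` (m `\` a) = m.
Proof.
by move=> /msubsetP am; apply/msetP => x; rewrite !msetE2 subnKC.
Qed.
Lemma msetDKl (a b : {mset nat}) : (a `+` b) `\` a = b.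
Proof. by apply/msetP => x; rewrite !msetE2 addKn. Qed.
Lemma msubDl (a b : {mset nat}) : a `<=` a `+` b.
Proof. by apply/msubsetP => x; rewrite msetE2 leq_addr. Qed.
Lemma msubDr (a b : {mset nat}) : b `<=` a `+` b.
Proof. by rewrite msetDC msubDl. Qed.

Lemma fps_mulE S f g m : uniq S -> {subset submsets m <= S} ->
  fps_mul f g m = \sum_(a <- S) \sum_(b <- S | a `+` b == m) f a * g b.
Proof.
move=> uS mS; rewrite unlock /=.
transitivity (\sum_(a <- S | a `<=` m) f a * g (m `\` a)).
  rewrite -[RHS]big_filter; apply: perm_big; apply: uniq_perm.
  - exact: submsets_uniq.
  - exact: filter_uniq.
  move=> d; rewrite mem_filter mem_submsets; case: (boolP (d `<=` m)) => //= dm.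
  by rewrite mS// mem_submsets.
rewrite big_mkcond; apply: eq_bigr => a _.
case: ifPn => [am|nam]; last first.
  rewrite big_pred0// => b; apply: contraNF nam => /eqP <-; exact: msubDl.
have maS : m `\` a \in S.
  by apply: mS; rewrite mem_submsets -{2}(msetDB am) msubDr.
rewrite -big_filter (_ : [seq b <- S | _] = [:: m `\` a]) ?big_seq1//.
apply: perm_small_eq => //; apply: uniq_perm => //; first exact: filter_uniq.
move=> b; rewrite mem_filter inE; apply/andP/eqP => [[/eqP <- _]|->].
  by rewrite msetDKl.
by rewrite msetDB.
Qed.

Fact fps_mulC : commutative (@fps_mul R).
Proof.
move=> f g; apply/fpsP => m.
rewrite !(@fps_mulE (submsets m)) ?submsets_uniq//.
rewrite (exchange_big_dep predT)//=; apply: eq_bigr => a _.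
by apply: eq_big => [b|b _]; rewrite 1?msetDC 1?mulrC.
Qed.

Fact fps_mulA : associative (@fps_mul R).
Proof.
suff E f g h m : fps_mul f (fps_mul g h) m =
    \sum_(a <- submsets m) \sum_(b <- submsets m)
      \sum_(c <- submsets m | a `+` b `+` c == m) f a * g b * h c.
  move=> f g h; apply/fpsP => m.
  rewrite [RHS](congr1 (fun p : fps R => p m) (fps_mulC _ _)) !E.
  rewrite [LHS](eq_bigr (fun a => \sum_(c <- submsets m)
     \sum_(b <- submsets m | a `+` b `+` c == m) f a * g b * h c)); last first.
    move=> a _; rewrite [LHS](exchange_big_dep predT)//=.
  rewrite exchange_big/=; apply: eq_bigr => c _; apply: eq_bigr => a _.
  apply: eq_big => [b|b _]; last by rewrite mulrC mulrA.
  by rewrite -[c `+` a `+` b]msetDA (msetDC c).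
have uS := submsets_uniq m; rewrite (@fps_mulE (submsets m))//.
rewrite big_seq [RHS]big_seq; apply: eq_bigr => a aS.
transitivity (\sum_(p <- submsets m | a `+` p == m)
   \sum_(b <- submsets m) \sum_(c <- submsets m | b `+` c == p) f a * (g b * h c)).
  apply: eq_bigr => p /eqP pm; rewrite (@fps_mulE (submsets m))//; last first.
    move=> d; rewrite !mem_submsets => /msubset_trans; apply.
    by rewrite -pm msubDr.
  by rewrite mulr_sumr; apply: eq_bigr => b _; rewrite mulr_sumr.
rewrite exchange_big/=; apply: eq_bigr => b _.
rewrite (exchange_big_dep (fun c => a `+` b `+` c == m))/=; last first.
  by move=> p c /eqP <- /eqP <-; rewrite msetDA.
apply: eq_bigr => c /eqP cm; rewrite -big_filter.
rewrite (_ : [seq _ <- _ | _] = [:: b `+` c]) ?big_seq1 ?mulrA//.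
apply: perm_small_eq => //; apply: uniq_perm => //; first exact: filter_uniq.
move=> p; rewrite mem_filter inE mem_submsets.
apply/andP/eqP => [[/andP[_ /eqP <-]]//|->].
by rewrite msetDA cm !eqxx/=; split=> //; rewrite -cm -msetDA msubDr.
Qed.

Lemma fpsC_mulE c f m : fps_mul (fpsC c) f m = c * f m.
Proof.
rewrite fps_mul.unlock /= (bigD1_seq mset0) ?submsets_uniq//=; last first.
  by rewrite mem_submsets; apply/msubsetP => x; rewrite mset0E.
rewrite fpsCE eqxx big1 ?addr0 => [|d]; last rewrite fpsCE => /negPf ->; last by rewrite mul0r.
by congr (_ * f _); apply/msetP => x; rewrite msetE2 mset0E subn0.
Qed.
Fact fps_mul1 : left_id (fpsC 1) (@fps_mul R).
Proof. by move=> f; apply/fpsP => m; rewrite fpsC_mulE mul1r. Qed.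
Fact fps_mulDl : left_distributive (@fps_mul R) +%R.
Proof.
move=> f g h; apply/fpsP => m; rewrite unlock /= -big_split/=.
by apply: eq_bigr => d _; rewrite mulrDl.
Qed.
Fact fps_1neq0 : fpsC 1 != 0 :> fps R.
Proof.
apply/eqP => /fpsP /(_ mset0); rewrite fpsCE eqxx; apply/eqP; exact: oner_neq0.
Qed.
HB.instance Definition _ := GRing.Zmodule_isComNzRing.Build (fps R)
  fps_mulA fps_mulC fps_mul1 fps_mulDl fps_1neq0.

Lemma fpsDE f g m : (f + g) m = f m + g m. Proof. by []. Qed.
Lemma fpsNE f m : (- f) m = - f m. Proof. by []. Qed.
Lemma fps0E m : (0 : fps R) m = 0. Proof. by []. Qed.
Lemma fps1E m : (1 : fps R) m = (m == mset0)%:R.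
Proof. by rewrite fpsCE; case: eqP. Qed.
Lemma fpsME f g m : (f * g) m = \sum_(d <- submsets m) f d * g (m `\` d).
Proof. by rewrite /GRing.mul/= unlock. Qed.
Lemma fpsCME c f m : (fpsC c * f) m = c * f m. Proof. exact: fpsC_mulE. Qed.

Fact fpsC_additive : {morph @fpsC R : x y / x - y}.
Proof. by move=> x y; apply/fpsP => m; rewrite /= !fpsCE; case: ifP; rewrite ?subr0. Qed.
Fact fpsC_multiplicative : monoid_morphism (@fpsC R).
Proof.
split=> // x y; apply/fpsP => m; rewrite fpsCME !fpsCE.
by case: ifP; rewrite ?mulr0.
Qed.
HB.instance Definition _ :=
  GRing.isZmodMorphism.Build R (fps R) (@fpsC R) fpsC_additive.
HB.instance Definition _ :=
  GRing.isMonoidMorphism.Build R (fps R) (@fpsC R) fpsC_multiplicative.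

Definition fps_unit : pred (fps R) := fun f => `[< exists g, g * f = 1 >].
Definition fps_inv f : fps R :=
  if fps_unit f then xget f [set g | g * f = 1] else f.

Fact fps_mulVx : {in fps_unit, left_inverse 1 fps_inv *%R}.
Proof.
move=> f uf; rewrite /fps_inv (uf : fps_unit f = true).
by have /asboolP[g gf] := uf; case: xgetP => [_ _ //|/(_ g)]; case.
Qed.
Fact fps_unitPl f g : g * f = 1 -> fps_unit f.
Proof. by move=> gf; apply/asboolP; exists g. Qed.
Fact fps_inv_out : {in [predC fps_unit], fps_inv =1 id}.
Proof. by move=> f uf; rewrite /fps_inv (negPf (uf : ~~ fps_unit f)). Qed.
HB.instance Definition _ := GRing.ComNzRing_hasMulInverse.Build (fps R)
  fps_mulVx fps_unitPl fps_inv_out.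

Definition fps_restrict (n : nat) f : fps R :=
  Fps (fun m => if all (fun i => i < n)%N m then f m else 0).

Definition fps_sum (I : choiceType) (A : set I) (F : I -> fps R) : fps R :=
  Fps (fun m => \sum_(i \in A) F i m).
End FpsRing.

Notation "''x_' i" := (@fpsX _ i) (at level 8, i at level 2, format "''x_' i").

Definition is_partition (la : seq nat) := sorted geq la && (0%N \notin la).

Section Grothendieck.
Variables (R : comNzRingType) (alpha beta : nat -> R).
Implicit Types (la : seq nat) (n : nat).

Definition grothendieck_mx la n : 'M[fps R]_n :=
  \matrix_(i < n, j < n)
    ('x_j ^+ (nth 0%N la i + n - i.+1)
     * (\prod_(k < i) (1 - fpsC (beta k) * 'x_j))
     / (\prod_(k < nth 0%N la i) (1 - fpsC (alpha k) * 'x_j))).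

Definition vandermonde n : fps R :=
  \prod_(i < n) \prod_(j < n | (i < j)%N) ('x_i - 'x_j).

Definition is_grothendieck la (g : fps R) : Prop :=
  forall n, (size la <= n)%N ->
    fps_restrict n g * vandermonde n = \det (grothendieck_mx la n).

Definition grothendieck la : fps R := xget 0 [set g | is_grothendieck la g].

End Grothendieck.

Definition marked_mset := seq (nat * bool).

Definition marked_le (a b : nat * bool) : bool :=
  if b.2 then (a.1 < b.1)%N else (a.1 <= b.1)%N.

Definition is_marked_mset (c : marked_mset) : bool :=
  if c is a :: c' then ~~ a.2 && path marked_le a c' else false.

Definition cell_min (c : marked_mset) : nat := head 0%N (unzip1 c).
Definition cell_max (c : marked_mset) : nat := last 0%N (unzip1 c).

Definition unmarked (c : marked_mset) : nat := count (fun a => ~~ a.2) c.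
Definition marked (c : marked_mset) : nat := count (fun a => a.2) c.

Definition filling := seq (seq marked_mset).

Definition cell (T : filling) (i j : nat) : marked_mset :=
  nth [::] (nth [::] T i) j.

Record is_MMSVT (la : seq nat) (T : filling) : Prop := {
  MMSVT_shape : shape T = la ;
  MMSVT_cell : forall i j, (j < nth 0%N la i)%N -> is_marked_mset (cell T i j) ;
  MMSVT_row : forall i j, (j.+1 < nth 0%N la i)%N ->
    (cell_max (cell T i j) <= cell_min (cell T i j.+1))%N ;
  MMSVT_col : forall i j, (j < nth 0%N la i)%N -> (j < nth 0%N la i.+1)%N ->
    (cell_max (cell T i j) < cell_min (cell T i.+1 j))%N
}.

Definition MMSVT (la : seq nat) : set filling := [set T | is_MMSVT la T].

Definition wt (R : comNzRingType) (alpha beta : nat -> R) (T : filling) : fps R :=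
  \prod_(i < size T) \prod_(j < size (nth [::] T i))
    ((\prod_(a <- cell T i j) 'x_(a.1))
     * fpsC (alpha j ^+ (unmarked (cell T i j)).-1
             * (- beta i) ^+ marked (cell T i j))).

(* Main.v *)
(** Both sides obey the same branching rule in the largest variable [z = x_n].
    On the determinant, combining consecutive rows annihilates the column of
    [z], because [(y - z) * sum_k branch_wt k * prod_(l < k) y / (1 - alpha_l y)]
    telescopes to a combination of two rows; expanding what is left by
    multilinearity in the rows gives a sum of the [n]-variable determinants over
    the interlacing partitions.  On tableaux, the ways to put the letters [z] back
    in a tableau in smaller letters are independent from cell to cell: a cell is
    unchanged, or receives a tail [z ... z] whose first letter may be marked, or is
    new and consists of copies of [z], and the sums over the last two kinds are
    geometric series.  Uniqueness of the power series holds since [x_i - x_j] is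
    not a zero divisor.  Along the induction, partitions are padded with zeros to
    have exactly [n] parts. *)
Require Import Defs.
From mathcomp Require Import all_boot all_order all_algebra.
From mathcomp Require Import finmap multiset.
From mathcomp Require Import boolp classical_sets functions cardinality fsbigop.
From mathcomp Require Import zify ring.

Set Implicit Arguments.
Unset Strict Implicit.
Unset Printing Implicit Defensive.

Import GRing.Theory.
Local Open Scope ring_scope.
Local Open Scope mset_scope.

(** * Formally summable families *)

(** The sum over a set is taken over its support, and is zero by convention when that support is
    infinite. A list containing the support turns it into an ordinary big sum, to which exchange and
    distributivity apply. *)
Lemma fsum_seq (R : nmodType) (I : choiceType) (A : set I) (F : I -> R)
    (s : seq I) :
  uniq s -> (forall i, A i -> F i <> 0 -> i \in s) ->
  \sum_(i \in A) F i = \sum_(i <- s | `[< A i >]) F i.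
Proof.
move=> us sP; rewrite -[RHS]big_filter [RHS]fsbig_seq ?filter_uniq//.
rewrite [RHS](@fsbig_widen _ _ _ _ _ A)//= => [i /=|i [/= Ai]].
  by rewrite mem_filter => /andP[/asboolP].
rewrite mem_filter (asboolT Ai)/= => nis; by apply: contrapT => /(sP _ Ai).
Qed.

Section Summable.
Variable R : comNzRingType.

(** Coefficientwise finiteness: it ensures that [fps_sum] is computed by genuine finite sums and
    never by the default value for infinite support. *)
Definition summable (I : choiceType) (A : set I) (F : I -> fps R) :=
  forall m, exists s : seq I, forall i, A i -> F i m <> 0 -> i \in s.

Lemma summable_subset (I : choiceType) (A B : set I) (F : I -> fps R) :
  (forall i, A i -> B i) -> summable B F -> summable A F.
Proof. by move=> AB sB m; have [s sP] := sB m; exists s => i /AB; apply: sP. Qed.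

(** A coefficient of a product involves all submultisets of a monomial, so one list must serve
    finitely many monomials at once. *)
Lemma summable_below (I : choiceType) (A : set I) (F : I -> fps R)
    (ms : seq {mset nat}) :
  summable A F ->
  exists2 s : seq I, uniq s &
    forall i m, m \in ms -> A i -> F i m <> 0 -> i \in s.
Proof.
move=> sF; elim: ms => [|m ms [s us sP]]; first by exists [::].
have [t tP] := sF m; exists (undup (t ++ s)); first exact: undup_uniq.
move=> i m'; rewrite inE mem_undup mem_cat => /predU1P[->|m's] Ai Fi.
  by rewrite tP.
by rewrite (sP i m') ?orbT.
Qed.

Lemma fps_sumE (I : choiceType) (A : set I) (F : I -> fps R) m (s : seq I) :
  uniq s -> (forall i, A i -> F i m <> 0 -> i \in s) ->
  fps_sum A F m = \sum_(i <- s | `[< A i >]) F i m.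
Proof. exact: fsum_seq. Qed.

Lemma eq_fps_sum (I : choiceType) (A B : set I) (F G : I -> fps R) :
  (forall i, A i <-> B i) -> (forall i, A i -> F i = G i) ->
  fps_sum A F = fps_sum B G.
Proof.
move=> AB FG; have -> : B = A by apply/seteqP; split=> i /AB.
by apply/fpsP => m; apply: eq_fsbigr => i; rewrite inE => /FG ->.
Qed.

Lemma eq_summable (I : choiceType) (A : set I) (F G : I -> fps R) :
  (forall i, A i -> F i = G i) -> summable A F -> summable A G.
Proof.
move=> FG sF m; have [s sP] := sF m.
by exists s => i Ai; rewrite -FG//; apply: sP.
Qed.

Lemma summable1 (I : choiceType) (i : I) (F : I -> fps R) :
  summable [set i]%classic F.
Proof. by move=> m; exists [:: i] => j /= -> _; rewrite inE. Qed.

Lemma fps_sum1 (I : choiceType) (i : I) (F : I -> fps R) :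
  fps_sum [set i]%classic F = F i.
Proof. by apply/fpsP => m; rewrite /= fsbig_set1. Qed.

Lemma fps_sumT (I : finType) (A : set I) (F : I -> fps R) :
  fps_sum A F = \sum_(i | `[< A i >]) F i.
Proof.
apply/fpsP => m; rewrite (@fps_sumE _ _ _ _ (index_enum I)) ?index_enum_uniq//; last first.
  by move=> i _ _; rewrite mem_index_enum.
have cM : {morph @coef R ^~ m : x y / x + y} by [].
by rewrite -(big_morph (fun f : fps R => f m) cM (fps0E _ m)).
Qed.

(** The hypotheses make [fib j] the fibre of [p] over [j], but leave its description free, so that a
    fibre can be given as an explicit family such as the extensions of a smaller tableau. *)
Lemma fps_sum_fiber (I J : choiceType) (A : set I) (K : set J)
    (fib : J -> set I) (p : I -> J) (F : I -> fps R) :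
  summable A F ->
  (forall i, A i -> K (p i) /\ fib (p i) i) ->
  (forall j i, K j -> fib j i -> A i /\ p i = j) ->
  fps_sum A F = fps_sum K (fun j => fps_sum (fib j) F).
Proof.
move=> sF AK KA; apply/fpsP => m; have [s us sP] := summable_below [:: m] sF.
have {}sP i : A i -> F i m <> 0 -> i \in s by apply: sP; rewrite inE.
have fibE j : K j ->
    fps_sum (fib j) F m = \sum_(i <- s | `[< A i >] && (p i == j)) F i m.
  move=> Kj; rewrite (@fps_sumE _ _ _ _ s)//; last by move=> i /(KA _ _ Kj)[/sP].
  apply: eq_bigl => i; apply/asboolP/andP => [/(KA _ _ Kj)[Ai ->]|].
    by split=> //; apply/asboolP.
  by case=> /asboolP/AK[_] + /eqP <-.
rewrite (fps_sumE us sP) (@fps_sumE _ _ _ _ (undup (map p s))) ?undup_uniq//.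
  rewrite (eq_bigr (fun j => \sum_(i <- s | `[< A i >] && (p i == j)) F i m));
    last by move=> j /asboolP; exact: fibE.
  rewrite (exchange_big_dep (fun i => `[< A i >]))/=; last by move=> ? ? _ /andP[].
  rewrite big_seq_cond [RHS]big_seq_cond; apply: eq_bigr => i /andP[si /asboolP Ai].
  rewrite (big_rem (p i)) ?mem_undup ?map_f//= (asboolT Ai) eqxx.
  rewrite (asboolT (proj1 (AK i Ai))) /= big_seq_cond big_pred0 ?addr0// => j.
  rewrite mem_rem_uniq ?undup_uniq// inE /= eq_sym.
  by case: eqP => //=; rewrite !andbF.
(* An index outside the image of [s] has a vanishing inner sum, so the image is a large enough list
   for the outer sum. *)
move=> j Kj; rewrite fibE// mem_undup; apply: contra_notT => jp.
rewrite big_seq_cond big1// => i /and3P[si _ /eqP pij].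
by rewrite -pij map_f in jp.
Qed.

Lemma fps_sum_reindex (I J : choiceType) (A : set I) (B : set J)
    (h : J -> I) (F : I -> fps R) :
  set_bij B A h -> fps_sum A F = fps_sum B (F \o h).
Proof. by move=> hb; apply/fpsP => m; rewrite /= (reindex_fsbig h B A). Qed.

Lemma summable_reindex (I J : choiceType) (A : set I) (B : set J)
    (h : J -> I) (F : I -> fps R) :
  set_bij B A h -> summable B (F \o h) -> summable A F.
Proof.
move=> [hf hi hs] sF m; have [s sP] := sF m; exists (map h s) => i Ai Fi.
have [j Bj hj] := hs i Ai; rewrite -hj map_f// sP//=; by rewrite hj.
Qed.

Lemma fpsM_neq0 (f g : fps R) m : (f * g) m <> 0 ->
  exists2 d, d \in submsets m & f d <> 0 /\ g (m `\` d) <> 0.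
Proof.
apply: contra_notP => nE; rewrite fpsME big_seq big1// => d dm.
apply: contrapT => fg; apply: nE; exists d => //.
by split=> z; apply: fg; rewrite z ?mul0r ?mulr0.
Qed.

Lemma summable_mul (I J : choiceType) (A : set I) (B : set J)
    (F : I -> fps R) (G : J -> fps R) :
  summable A F -> summable B G ->
  summable (A `*` B)%classic (fun p => F p.1 * G p.2).
Proof.
move=> sF sG m.
have [s us sP] := summable_below (submsets m) sF.
have [t ut tP] := summable_below (submsets m) sG.
exists (allpairs pair s t) => -[i j] [/= Ai Bj] /fpsM_neq0[d dm [Fi Gj]].
apply/allpairsP; exists (i, j); split=> //=; first exact: sP dm Ai Fi.
by apply: tP Bj Gj; rewrite mem_submsets msubsetDl.
Qed.

(** At a fixed [m] only submultisets of [m] occur on either side, so the lists [s] and [t] reduce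
    the claim to distributivity of finite sums. *)
Lemma fps_sum_mul (I J : choiceType) (A : set I) (B : set J)
    (F : I -> fps R) (G : J -> fps R) :
  summable A F -> summable B G ->
  fps_sum (A `*` B)%classic (fun p => F p.1 * G p.2) =
  fps_sum A F * fps_sum B G.
Proof.
move=> sF sG; apply/fpsP => m.
have [s us sP] := summable_below (submsets m) sF.
have [t ut tP] := summable_below (submsets m) sG.
rewrite (@fps_sumE _ _ _ _ (allpairs pair s t)).
- rewrite [RHS]fpsME big_mkcond big_allpairs_dep/= [RHS]big_seq.
  transitivity (\sum_(d <- submsets m | d \in submsets m)
      \sum_(i <- s | `[< A i >]) \sum_(j <- t | `[< B j >]) F i d * G j (m `\` d)).
    rewrite -big_seq [RHS]exchange_big/= [RHS]big_mkcond.
    apply: eq_bigr => i _; case: asboolP => [Ai|nA]; last first.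
      by apply: big1 => j _; case: asboolP => // -[].
    rewrite [RHS]exchange_big/= [RHS]big_mkcond; apply: eq_bigr => j _.
    rewrite -fpsME; congr (if _ then _ else _).
    by apply: asbool_equiv_eq; split=> [[]|].
  apply: eq_bigr => d dm.
  rewrite (@fsum_seq _ _ _ _ s)//; last by move=> i; exact: sP.
  rewrite (@fsum_seq _ _ _ _ t)//; last first.
    by move=> j; apply: tP; rewrite mem_submsets msubsetDl.
  by rewrite big_distrlr.
- by apply: allpairs_uniq => // -[? ?] [? ?] _ _ [-> ->].
move=> [i j] [/= Ai Bj] /fpsM_neq0[d dm [Fi Gj]].
apply/allpairsP; exists (i, j); split=> //=; first exact: sP dm Ai Fi.
by apply: tP Bj Gj; rewrite mem_submsets msubsetDl.
Qed.

Lemma fps_sum_mull (I : choiceType) (A : set I) (c : fps R) (F : I -> fps R) :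
  summable A F -> fps_sum A (fun i => c * F i) = c * fps_sum A F.
Proof.
move=> sF; rewrite -{2}(fps_sum1 tt (fun=> c)) -fps_sum_mul//; last exact: summable1.
rewrite [RHS](@fps_sum_reindex _ _ _ A (pair tt))//; split.
- by move=> i.
- by move=> i j _ _ [].
- by move=> [[] i] [_ Ai]; exists i.
Qed.

(** Distributivity for independent choices: splitting off the head of a list splits off one factor,
    and [fps_sum_mul] separates it from the rest. *)
Lemma fps_sum_seq (I : choiceType) (x0 : I) (n : nat) (C : nat -> set I)
    (W : nat -> I -> fps R) :
  (forall j, (j < n)%N -> summable (C j) (W j)) ->
  let A := [set s | size s = n /\ forall j, (j < n)%N -> C j (nth x0 s j)]%classic in
  let F := fun s => \prod_(j < n) W j (nth x0 s j) in
  summable A F /\ fps_sum A F = \prod_(j < n) fps_sum (C j) (W j).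
Proof.
elim: n C W => [|n IH] C W sW A F.
  have AE i : A i <-> [set [::]]%classic i.
    by split=> [[/size0nil ->]|/= ->].
  split; first by apply: summable_subset (@summable1 _ [::] _) => i /AE.
  rewrite (eq_fps_sum AE (fun i _ => erefl _)).
  by rewrite fps_sum1 /F !big_ord0.
have [|sT ST] := IH (fun j => C j.+1) (fun j => W j.+1).
  by move=> j jn; apply: sW.
have hb : set_bij (C 0%N `*` [set s | size s = n /\
     forall j, (j < n)%N -> C j.+1 (nth x0 s j)])%classic A
   (fun p => p.1 :: p.2).
  split.
  - by move=> [x s] /= [Cx [sn Cs]]; split=> /=; [rewrite sn|case].
  - by move=> [x s] [y t] _ _ /= [-> ->].
  - move=> [|x s] [//= [sn] Cs]; exists (x, s) => //; split; first exact: (Cs 0%N).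
    by split=> // j jn; apply: (Cs j.+1).
split.
  apply: (summable_reindex hb).
  apply: eq_summable (summable_mul (sW 0%N isT) sT) => -[x s] _.
  by rewrite /F /= big_ord_recl.
rewrite (fps_sum_reindex _ hb) big_ord_recl -ST -fps_sum_mul//; last exact: sW.
by apply: eq_fps_sum => // -[x s] _; rewrite /F /= big_ord_recl.
Qed.

End Summable.

(** * Monomials, geometric series and regular elements *)

Section FpsTheory.
Variable R : comNzRingType.
Implicit Types (f g : fps R) (m : {mset nat}).

Lemma fpsXM i f m :
  ('x_i * f) m = if i \in m then f (m `\ i) else 0.
Proof.
rewrite fpsME; case: ifPn => im.
  rewrite (bigD1_seq [mset i]) ?submsets_uniq ?mem_submsets ?msub1set//=.
  rewrite fpsXE eqxx mul1r big1 ?addr0// => d /negPf di.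
  by rewrite fpsXE di mul0r.
rewrite big_seq big1// => d; rewrite mem_submsets fpsXE => dm.
by case: eqP dm => [->|]; rewrite ?mul0r// msub1set (negPf im).
Qed.

Lemma fps_monomialE (s : seq nat) m :
  (\prod_(a <- s) 'x_a : fps R) m = (m == seq_mset s)%:R.
Proof.
elim: s m => [|a s IH] m.
  by rewrite big_nil fps1E (_ : seq_mset [::] = mset0)//; apply/msetP => x;
    rewrite mset_seqE mset0E.
rewrite big_cons fpsXM mset_cons; case: ifPn => am.
  rewrite IH; congr (nat_of_bool _)%:R; apply/eqP/eqP => [<-|->].
    by rewrite msetB1K.
  by rewrite msetD1K.
by case: eqP am => // ->; rewrite mset1D1.
Qed.

Lemma fpsX_powE i k m : ('x_i ^+ k : fps R) m = (m == seq_mset (nseq k i))%:R.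
Proof.
rewrite -fps_monomialE; congr (coef _ m).
by elim: k => [|k IH]; rewrite ?big_nil// big_cons -IH exprS.
Qed.

Lemma summable_geometric (c : R) i :
  summable setT (fun k => (fpsC c * 'x_i) ^+ k).
Proof.
(* The [k]-th power is homogeneous of degree [k], so only [k = size m] can contribute. *)
move=> m; exists [:: size m] => k _; rewrite exprMn -rmorphXn fpsCME fpsX_powE.
case: eqP => [->|]; last by rewrite mulr0.
by rewrite (perm_size (perm_eq_seq_mset _)) size_nseq inE.
Qed.

Lemma fps_geometricP (c : R) i :
  (1 - fpsC c * 'x_i) * fps_sum setT (fun k => (fpsC c * 'x_i) ^+ k) = 1.
Proof.
have sT := summable_geometric c i; set y := fpsC c * 'x_i in sT *.
rewrite mulrBl mul1r.
have {1}-> : fps_sum setT (fun k => y ^+ k) =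
    1 + y * fps_sum setT (fun k => y ^+ k); last by rewrite addrK.
rewrite -fps_sum_mull//.
(* The fibres over [true] and [false] separate the term [k = 0] from the shifted series. *)
rewrite (@fps_sum_fiber _ _ _ _ [set: bool]%classic
   (fun b k => (k == 0%N) = b) (fun k => k == 0%N))//.
rewrite fps_sumT big_mkcond big_bool !asboolT//=; congr (_ + _).
  rewrite (@eq_fps_sum _ _ _ [set 0%N]%classic _ (fun k => y ^+ k)) ?fps_sum1//.
  by move=> k; split=> [/eqP|/= ->].
rewrite (@fps_sum_reindex _ _ _ _ setT succn); last first.
  split=> //; first by move=> k k' _ _ [].
  by case=> [|k] //= _; exists k.
by apply: eq_fps_sum => // k _ /=; rewrite exprS.
Qed.

Lemma one_subCX_unit (c : R) i : 1 - fpsC c * 'x_i \is a GRing.unit.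
Proof. by apply/unitrPr; eexists; apply: fps_geometricP. Qed.

Lemma fps_geometric (c : R) i :
  fps_sum setT (fun k => (fpsC c * 'x_i) ^+ k) = (1 - fpsC c * 'x_i)^-1.
Proof.
apply: (mulrI (one_subCX_unit c i)).
by rewrite fps_geometricP divrr// one_subCX_unit.
Qed.

(** The equation makes each coefficient equal to the one with a letter [j] replaced by [i], or zero
    if [j] is absent. Repeating the replacement exhausts the letters [j]. *)
Lemma subXX_regular i j f : i != j -> f * ('x_i - 'x_j) = 0 -> f = 0.
Proof.
move=> ij /fpsP f0; apply/fpsP => m; rewrite fps0E.
have fE m' : f m' = if j \in m' then f (i +` m' `\ j) else 0.
  have := f0 (i +` m'); rewrite mulrC mulrBl fpsDE fpsNE !fpsXM fps0E.
  rewrite mset1D1 msetD1K in_mset1D eq_sym (negPf ij)/= => /eqP.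
  rewrite subr_eq0 => /eqP ->; case: ifP => // jm; congr (f _); apply/msetP => x.
  rewrite msetB1E !mset1DE msetB1E; case: (eqVneq x j) => [->|_].
    by rewrite eq_sym (negPf ij).
  by rewrite !subn0.
have [k] := ubnP (m j); elim: k m => // k IH m; rewrite ltnS => mk.
rewrite fE; case: ifPn => // jm; apply: IH.
apply: leq_trans mk; rewrite mset1DE msetB1E eqxx eq_sym (negPf ij).
by rewrite add0n subn1 prednK// mset_gt0.
Qed.

Lemma vandermonde_regular n f : f * vandermonde R n = 0 -> f = 0.
Proof.
rewrite /vandermonde => f0.
have reg (I : Type) (r : seq I) (P : pred I) (F : I -> fps R) :
    (forall i, P i -> forall g, g * F i = 0 -> g = 0) ->
    forall g, g * (\prod_(i <- r | P i) F i) = 0 -> g = 0.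
  move=> regF; elim: r => [|i r IH] g; first by rewrite big_nil mulr1.
  rewrite big_cons; case: ifP => [Pi|_]; last exact: IH.
  by rewrite mulrA => /IH/(regF _ Pi).
apply: (reg _ _ _ _ _ _ f0) => i _; apply: reg => j ij g.
by apply: subXX_regular; rewrite neq_ltn ij.
Qed.

(** * Setting all but the first [n] variables to zero *)

Section Restrict.
Variable n : nat.

Lemma fps_restrictM f g :
  fps_restrict n (f * g) = fps_restrict n f * fps_restrict n g.
Proof.
apply/fpsP => m; rewrite /= !fpsME; case: ifPn => mn.
  rewrite big_seq [RHS]big_seq; apply: eq_bigr => d; rewrite mem_submsets => dm /=.
  rewrite !ifT//; apply/allP => i im; apply: (allP mn).
    by apply: msubset_subset im; rewrite msubsetDl.
  exact: msubset_subset im.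
rewrite big_seq big1// => d; rewrite mem_submsets => dm /=.
case: ifPn => dn; last by rewrite mul0r.
rewrite ifN ?mulr0//; apply: contraNN mn => dn'; apply/allP => i.
rewrite -(msetDB dm) in_msetD => /orP[]; [exact: (allP dn)|exact: (allP dn')].
Qed.

Lemma fps_restrictC (c : R) : fps_restrict n (fpsC c) = fpsC c.
Proof.
apply/fpsP => m /=; rewrite fpsCE; case: ifPn => //.
by case: eqP => // ->; rewrite enum_mset0.
Qed.

Lemma fps_restrictX i : fps_restrict n 'x_i = if (i < n)%N then 'x_i else 0 :> fps R.
Proof.
apply/fpsP => m /=; case: (ifPn (i < n)%N) => ni; rewrite ?fpsXE ?fps0E; case: ifPn => //.
  by case: eqP => // ->; rewrite enum_msetn /= ni.
by case: eqP => // ->; rewrite enum_msetn /= (negPf ni).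
Qed.

Lemma fps_restrict_prod (I : Type) (r : seq I) (F : I -> fps R) :
  fps_restrict n (\prod_(i <- r) F i) = \prod_(i <- r) fps_restrict n (F i).
Proof.
by apply: (big_morph _ fps_restrictM); rewrite -(rmorph1 (@fpsC R)) fps_restrictC.
Qed.

Lemma fps_restrict_sum (I : choiceType) (A : set I) (F : I -> fps R) :
  fps_restrict n (fps_sum A F) = fps_sum A (fun i => fps_restrict n (F i)).
Proof.
by apply/fpsP => m /=; case: ifP => // _; rewrite fsbig1.
Qed.

End Restrict.

(** A single monomial involves finitely many variables, so it survives every restriction with [n]
    large enough. *)
Lemma fps_restrict_inj f g :
  (exists n0, forall n, (n0 <= n)%N -> fps_restrict n f = fps_restrict n g) ->
  f = g.
Proof.
move=> [n0 fg]; apply/fpsP => m.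
pose n := maxn n0 (\max_(i <- m) i).+1.
suff mn : all (fun i => (i < n)%N) m.
  by have /fpsP/(_ m)/= := fg n (leq_maxl _ _); rewrite mn.
apply/allP => i im; rewrite leq_max ltnS orbC (big_rem i)//=.
by rewrite leq_maxl.
Qed.

End FpsTheory.

(** * The branching rule for the determinant *)

(** Multilinearity in all rows at once: a function [f] records which summand is chosen in each
    row. *)
Lemma det_row_sum (S : comNzRingType) n (J : finType) (P : 'I_n -> pred J)
    (c : 'I_n -> J -> S) (E : 'I_n -> J -> 'I_n -> S) :
  \det (\matrix_(i, j) \sum_(k | P i k) c i k * E i k j) =
  \sum_(f : {ffun 'I_n -> J} | [forall i, P i (f i)])
     (\prod_i c i (f i)) * \det (\matrix_(i, j) E i (f i) j).
Proof.
rewrite /determinant.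
under eq_bigr => s _.
  under eq_bigr do rewrite mxE.
  rewrite bigA_distr_big_dep mulr_sumr.
  over.
rewrite exchange_big; apply: eq_big => [f|f _].
  by apply/familyP/forallP.
rewrite mulr_sumr; apply: eq_bigr => s _.
rewrite big_split mulrCA; congr (_ * (_ * _)).
by apply: eq_bigr => i _; rewrite mxE.
Qed.

Section Branching.
Variables (S : comUnitRingType) (a b : nat -> S).
Implicit Types (y z : S).

(** The geometric series of a cell in column [k] filled with one or more copies of [y], all
    unmarked. *)
Definition pole k y := y / (1 - a k * y).

(** The determinant entry for a part [k], with the factor [y ^+ k] and the denominators merged into
    poles; rows for different [k] then differ only by a product of poles. *)
Definition row_entry n i k y :=
  y ^+ (n - i.+1) * (\prod_(l < i) (1 - b l * y)) * \prod_(0 <= l < k) pole l y.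

(* Generating function in [z], the largest variable, of the ways to add the
   letter [z] to a row of length [k], so as to obtain length [q] above a row of
   length [p]; for [k > p] the last old cell may also receive copies of [z]. *)
Definition branch_wt i p q z k :=
  (\prod_(k <= l < q) pole l z) *
  (if (p < k)%N then (1 - b i * z) / (1 - a k.-1 * z) else 1).

Lemma poleB k y z :
  1 - a k * y \is a GRing.unit -> 1 - a k * z \is a GRing.unit ->
  (y - z) / (1 - a k * z) * pole k y = y * (pole k y - pole k z).
Proof.
move=> /divrr uy /divrr uz; rewrite /pole.
move: uy uz; set u := (1 - a k * y)^-1; set v := (1 - a k * z)^-1 => uy uz.
(* Inserting the factors [(1 - a k * z) * v] and [(1 - a k * y) * u], both equal to 1, makes this a
   polynomial identity. *)
transitivity (y * (y * u * ((1 - a k * z) * v) - z * v * ((1 - a k * y) * u))).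
  by ring.
by rewrite uy uz !mulr1.
Qed.

(** Induction on [q], starting from [y * (1 - b i * z) - z * (1 - b i * y) = y - z] at [q = p].
    Raising [q] multiplies the old terms by [pole q z] and adds a top term; by [poleB] the latter
    replaces [pole q z] by [pole q y] in the first product only. *)
Lemma branch_sum i p q y z : (p <= q)%N ->
  (forall k, 1 - a k * y \is a GRing.unit) ->
  (forall k, 1 - a k * z \is a GRing.unit) ->
  (y - z) * (\sum_(p <= k < q.+1) branch_wt i p q z k * \prod_(p <= l < k) pole l y)
  = y * (1 - b i * z) * (\prod_(p <= l < q) pole l y)
    - z * (1 - b i * y) * (\prod_(p <= l < q) pole l z).
Proof.
move=> pq uy uz; elim: q pq => [|q IH].
  rewrite leqn0 => /eqP ->; rewrite big_nat1 /branch_wt !big_geq//=; ring.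
rewrite leq_eqVlt => /predU1P[->|].
  rewrite big_nat1 /branch_wt !big_geq// ltnn; ring.
rewrite ltnS => pq; rewrite big_nat_recr ?(leq_trans pq)//= mulrDr.
rewrite (eq_big_nat _ _ (F2 := fun k => pole q z *
    (branch_wt i p q z k * \prod_(p <= l < k) pole l y))); last first.
  move=> k /andP[pk kq]; rewrite /branch_wt big_nat_recr//=; ring.
rewrite -mulr_sumr mulrCA IH// /branch_wt ltnS pq (big_geq (leqnn _)) !big_nat_recr//=.
set P := \prod_(p <= l < q) pole l y; set Q := \prod_(p <= l < q) pole l z.
have := poleB (uy q) (uz q).
move: (pole q y) (pole q z) (1 - a q * z)^-1 => py pz v E.
transitivity (pz * (y * (1 - b i * z) * P - z * (1 - b i * y) * Q) +
  (1 - b i * z) * P * ((y - z) * v * py)); first by ring.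
rewrite E; ring.
Qed.

Definition branch_row (la : nat -> nat) n i z y :=
  \sum_(la i.+1 <= k < (la i).+1)
    branch_wt i (la i.+1) (la i) z k * row_entry n i k y.

(** Factors independent of [k] come out of the sum, and [branch_sum] does the rest. The surviving
    factors [y] and [1 - b i * y] are exactly what turns the entries into those of rows [i] and
    [i.+1] in size [n.+1]. *)
Lemma branch_rowE la n i y z : (i < n)%N -> (la i.+1 <= la i)%N ->
  (forall k, 1 - a k * y \is a GRing.unit) ->
  (forall k, 1 - a k * z \is a GRing.unit) ->
  (y - z) * branch_row la n i z y =
  (1 - b i * z) * row_entry n.+1 i (la i) y
  - z * (\prod_(la i.+1 <= l < la i) pole l z) *
    row_entry n.+1 i.+1 (la i.+1) y.
Proof.
move=> ni laS uy uz; rewrite /branch_row.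
rewrite [X in _ * X = _](eq_big_nat _ _ (F2 := fun k =>
    y ^+ (n - i.+1) * (\prod_(l < i) (1 - b l * y)) *
    (\prod_(0 <= l < la i.+1) pole l y) *
    (branch_wt i (la i.+1) (la i) z k * \prod_(la i.+1 <= l < k) pole l y)));
  last first.
  move=> k /andP[pk kq]; rewrite /row_entry.
  rewrite (big_cat_nat (n := la i.+1) (m := 0%N) (p := k))//=; ring.
rewrite -mulr_sumr mulrCA branch_sum// /row_entry !subSS.
rewrite big_ord_recr /= (big_cat_nat (n := la i.+1) (m := 0%N) (p := la i))//=.
rewrite -(subnSK ni) exprS; ring.
Qed.

(** After the row operations, expansion along the last column leaves its bottom entry, at [z = x n].
    Its factor formed of the [1 - b l * z] is the determinant of the row operations, and cancels
    because these elements are units. *)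
Lemma det_branch (la : nat -> nat) (x : nat -> S) n :
  (forall i, (i < n)%N -> (la i.+1 <= la i)%N) ->
  (forall k j, 1 - a k * x j \is a GRing.unit) ->
  (forall k j, 1 - b k * x j \is a GRing.unit) ->
  \det (\matrix_(i < n.+1, j < n.+1) row_entry n.+1 i (la i) (x j)) =
  (\prod_(j < n) (x j - x n)) * (\prod_(0 <= l < la n) pole l (x n)) *
  \det (\matrix_(i < n, j < n) branch_row la n i (x n) (x j)).
Proof.
move=> laS ua ub; set M := matrix_of_fun _ _; set z := x n.
(* Multiplying by the bidiagonal matrix [U] kills the last column of [M], except
   for its bottom entry, and leaves [branch_row] scaled by [x j - z]. *)
pose U : 'M[S]_n.+1 := \matrix_(i, j)
  if j == i then (if (i < n)%N then 1 - b i * z else 1)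
  else if (j == i.+1 :> nat) && (i < n)%N then
    - (z * \prod_(la i.+1 <= l < la i) pole l z)
  else 0.
have dU : \det U = \prod_(i < n) (1 - b i * z).
  rewrite -det_tr det_trig; last first.
    apply/is_trig_mxP => i j ij; rewrite !mxE -val_eqE /= ltn_eqF//.
    by rewrite ltn_eqF//; apply: leq_trans ij _.
  rewrite big_ord_recr /= !mxE eqxx ltnn mulr1; apply: eq_bigr => i _.
  by rewrite !mxE eqxx /= ltn_ord.
have UM i j : (U *m M) i j = if (i < n)%N then (x j - z) * branch_row la n i z (x j)
    else M i j.
  rewrite mxE (bigD1 i)//= mxE eqxx; case: ifPn => [ni|ni]; last first.
    rewrite mul1r big1 ?addr0// => k ki.
    by rewrite mxE (negPf ki) (negPf ni) andbF mul0r.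
  rewrite (branch_rowE ni (laS _ ni) (ua^~ j) (ua^~ n)).
  pose i1 : 'I_n.+1 := Ordinal (ni : (i.+1 < n.+1)%N).
  have ik : i1 != i by rewrite -val_eqE /= gtn_eqF.
  rewrite (bigD1 i1)//= big1 => [|k /andP[ki kSi]].
    by rewrite addr0 !mxE (negPf ik) eqxx /= ni mulNr.
  rewrite mxE (negPf ki) ifN ?mul0r//.
  by apply: contraNN kSi => /andP[/eqP kSi _]; apply/eqP/val_inj.
have uz : \prod_(i < n) (1 - b i * z) \is a GRing.unit.
  apply: (big_ind (fun u : S => u \is a GRing.unit)); rewrite ?unitr1//.
    by move=> u v uu uv; rewrite unitrM uu.
  by move=> i _; apply: ub.
apply: (mulrI uz); rewrite -{1}dU -det_mulmx (expand_det_col _ ord_max).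
rewrite (bigD1 ord_max)//= big1 ?addr0 => [|i ni]; last first.
  rewrite UM ifT; first by rewrite subrr !mul0r.
  by rewrite ltn_neqAle -ltnS ltn_ord andbT; apply: contraNN ni => /eqP ni; apply/eqP/val_inj.
rewrite UM ltnn /= mxE /row_entry subnn expr0 mul1r /cofactor.
rewrite -signr_odd addnn odd_double expr0 mul1r.
pose V : 'M[S]_n := \matrix_(i, j) branch_row la n i z (x j).
pose D := diag_mx (\row_(j < n) (x j - z)).
have -> : row' ord_max (col' ord_max (U *m M)) = V *m D.
  apply/matrixP => i j; rewrite mul_mx_diag !mxE mulrC.
  by have := UM (lift ord_max i) (lift ord_max j); rewrite mxE !lift_max ltn_ord.
have dD : \det D = \prod_(j < n) (x j - z).
  by rewrite det_diag; apply: eq_bigr => j _; rewrite mxE.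
rewrite det_mulmx dD -/V; ring.
Qed.

End Branching.

(** * Largest letter of a cell *)

Section Cells.
Variable n : nat.
Implicit Types c d : marked_mset.

Definition below c := [seq a <- c | (a.1 < n)%N].
(** Among copies of [n] only the first can be marked, since a mark demands a strictly smaller
    predecessor; [b] records that mark and [k] counts the unmarked copies. *)
Definition max_tail (b : bool) (k : nat) : marked_mset :=
  nseq b (n, true) ++ nseq k (n, false).

Lemma marked_le_trans : transitive marked_le.
Proof.
move=> [y b] [x a] [z e]; rewrite /marked_le /=.
by case: b; case: e => xy yz; lia.
Qed.

Lemma marked_mset_cell_bounds c a : is_marked_mset c -> a \in c ->
  (cell_min c <= a.1 <= cell_max c)%N.
Proof.
case: c => // a0 c /= /andP[_]; rewrite /cell_min /cell_max /=.
have le_fst x y : marked_le x y -> (x.1 <= y.1)%N.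
  by rewrite /marked_le; case: ifP => // _; apply: ltnW.
elim: c a0 a => [|a1 c IH] a0 a /=; first by rewrite inE => _ /eqP ->; rewrite leqnn.
move=> /andP[/le_fst a01 ac]; rewrite inE => /predU1P[->|].
  rewrite leqnn; apply: leq_trans a01 _.
  by have /andP[] := IH a1 a1 ac (mem_head _ _).
by move=> /(IH _ _ ac)/andP[a1a ->]; rewrite (leq_trans a01).
Qed.

Lemma cell_min_max c : is_marked_mset c -> (cell_min c <= cell_max c)%N.
Proof.
by case: c => // a c mc; have /andP[+ +] := marked_mset_cell_bounds mc (mem_head _ _);
  apply: leq_trans.
Qed.

Lemma unmarked_gt0 c : is_marked_mset c -> (0 < unmarked c)%N.
Proof. by case: c => // a c /= /andP[na _]; rewrite /unmarked /= na. Qed.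

Lemma cell_max_mem c : is_marked_mset c -> exists2 a, a \in c & cell_max c = a.1.
Proof.
case: c => // a c _; exists (last a c); first exact: mem_last.
by rewrite /cell_max /= last_map.
Qed.

Lemma below_id c : is_marked_mset c -> (cell_max c < n)%N -> below c = c.
Proof.
move=> mc cn; apply/all_filterP/allP => a ac.
by have /andP[_ /leq_ltn_trans] := marked_mset_cell_bounds mc ac; apply.
Qed.

Lemma marked_mset_below c : is_marked_mset c -> (cell_min c < n)%N ->
  [/\ is_marked_mset (below c), cell_min (below c) = cell_min c,
      (cell_max (below c) <= cell_max c)%N & (cell_max (below c) < n)%N].
Proof.
case: c => // a c mc an; have mbc : is_marked_mset (below (a :: c)).
  rewrite /below /= (an : (a.1 < n)%N) /=.
  by have /andP[-> /(path_filter marked_le_trans)->] := mc.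
have [x xb xE] := cell_max_mem mbc; move: (xb); rewrite mem_filter => /andP[xn xc].
split=> //; first by rewrite /below /= (an : (a.1 < n)%N).
  by rewrite xE; have /andP[] := marked_mset_cell_bounds mc xc.
by rewrite xE.
Qed.

(** After a letter [n], a marked letter would have to exceed [n], so only unmarked copies of [n] can
    follow. *)
Lemma path_max_tail a c : a.1 = n -> path marked_le a c ->
  all (fun a => a.1 < n.+1)%N c -> c = nseq (size c) (n, false).
Proof.
elim: c a => //= -[x b] c IH a an /andP[ax xc] /andP[/= xn cn].
have xE : (x, b) = (n, false).
  by case: b ax {xc} => /=; rewrite /marked_le /= => ax; congr pair; lia.
by rewrite xE in xc *; rewrite {1}(IH (n, false) erefl xc cn).
Qed.

Lemma below_max_tail b k : below (max_tail b k) = [::].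
Proof. by apply/eqP; rewrite /below filter_cat !filter_nseq ltnn. Qed.

Lemma path_below a c : path marked_le a c -> all (fun a => a.1 < n.+1)%N c ->
  exists b k, c = below c ++ max_tail b k.
Proof.
elim: c a => [|x c IH] a /=; first by exists false, 0%N.
move=> /andP[ax xc] /andP[xn cn]; case: (ltnP x.1 n) => nx.
  by have [b [k cE]] := IH _ xc cn; exists b, k; rewrite {1}cE.
have xE : x.1 = n by lia.
rewrite (path_max_tail xE xc cn); move: (size c) => k.
(* The first [n] supplies the flag when marked, and otherwise counts as one more unmarked copy. *)
exists x.2, (k + ~~ x.2)%N. rewrite /below /= filter_nseq ltnn /=.
case: x xE {ax xc xn nx} => y b /= ->.
by case: b; rewrite /max_tail /= ?addn0 ?addn1.
Qed.

Lemma marked_mset_split c : is_marked_mset c -> (cell_min c < n)%N ->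
  all (fun a => a.1 < n.+1)%N c -> exists b k, c = below c ++ max_tail b k.
Proof.
case: c => // a c /andP[_ ac] an /andP[_ cn].
have [b [k cE]] := path_below ac cn; exists b, k.
by rewrite {1}cE /below /= (an : (a.1 < n)%N).
Qed.

Lemma marked_mset_pure c : is_marked_mset c -> (n <= cell_min c)%N ->
  all (fun a => a.1 < n.+1)%N c -> exists k, c = nseq k.+1 (n, false).
Proof.
case: c => // -[x b] c /andP[/= nb ac]; rewrite /cell_min /= => nx /andP[xn cn].
have xE : x = n by lia.
exists (size c); rewrite {1}(path_max_tail _ ac cn)//= xE.
by case: b nb {ac}.
Qed.

Lemma marked_mset_max_tail c b k : is_marked_mset c -> (cell_max c < n)%N ->
  [/\ is_marked_mset (c ++ max_tail b k),
      cell_min (c ++ max_tail b k) = cell_min c,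
      below (c ++ max_tail b k) = c &
      all (fun a => a.1 < n.+1)%N (c ++ max_tail b k)].
Proof.
move=> mc cn; split.
- case: c mc cn => // a c /= /andP[-> ac]; rewrite cat_path ac /=.
  rewrite /cell_max /= last_map; move: (last a c) => l ln.
  have nk x : (x.1 <= n)%N -> path marked_le x (nseq k (n, false)).
    elim: k x => //= k IH x xn; rewrite IH//= andbT.
    by rewrite /marked_le.
  by case: b => /=; rewrite ?nk// ?andbT; rewrite /marked_le//= ltnW.
- by case: c mc {cn}.
- by rewrite /below filter_cat -!/(below _) below_max_tail cats0 below_id.
rewrite all_cat; apply/andP; split.
  rewrite -(below_id mc cn); apply/allP => a.
  by rewrite mem_filter => /andP[/ltnW].
by rewrite all_cat !all_nseq /= leqnn !orbT.
Qed.

Lemma marked_mset_nseq k :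
  [/\ is_marked_mset (nseq k.+1 (n, false)), cell_min (nseq k.+1 (n, false)) = n &
      all (fun a => a.1 < n.+1)%N (nseq k.+1 (n, false))].
Proof.
split=> //; last by rewrite all_nseq /= leqnn.
by rewrite /=; elim: k => //= k ->; rewrite /marked_le /= leqnn.
Qed.

End Cells.

(** * Weights of cells and of fillings with independent cells *)

Section Weights.
Variables (R : comNzRingType) (alpha beta : nat -> R).
Implicit Types (c d : marked_mset) (T : filling).

Let a k : fps R := fpsC (alpha k).
Let b k : fps R := fpsC (beta k).

Definition cell_wt i j c : fps R :=
  (\prod_(a <- c) 'x_(a.1)) *
  fpsC (alpha j ^+ (unmarked c).-1 * (- beta i) ^+ marked c).

(** A cell contributing to the monomial [m] is an ordering of [m] together with one of finitely many
    lists of marks. *)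
Lemma summable_cell_wt A i j : summable A (cell_wt i j).
Proof.
move=> m; exists [seq zip s (val u) | s <- permutations m,
  u <- enum {: (size m).-tuple bool}] => c _ cm.
have {cm} mE : m = seq_mset (unzip1 c).
  apply: contra_notP cm => cm; rewrite /cell_wt mulrC fpsCME.
  have -> : \prod_(a <- c) 'x_(a.1) = \prod_(x <- unzip1 c) 'x_x :> fps R.
    by rewrite big_map.
  by rewrite fps_monomialE; case: eqP => // _; rewrite mulr0.
have sE : size (unzip2 c) == size m.
  by rewrite mE (perm_size (perm_eq_seq_mset _)) !size_map.
apply/allpairsP; exists (unzip1 c, Tuple sE); split=> /=.
- by rewrite mem_permutations mE perm_sym perm_eq_seq_mset.
- by rewrite mem_enum.
- by rewrite zip_unzip.
Qed.

Lemma wtE T : wt alpha beta T =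
  \prod_(i < size T) \prod_(j < size (nth [::] T i)) cell_wt i j (cell T i j).
Proof. by []. Qed.

Lemma cell_wt_pure i j n k :
  cell_wt i j (nseq k.+1 (n, false)) = 'x_n * (a j * 'x_n) ^+ k.
Proof.
rewrite /cell_wt big_nseq_cond /= iter_mulr_1 /unmarked /marked !count_nseq /=.
rewrite mul0n expr0 mulr1 mul1n /= rmorphXn /= exprMn /a; ring.
Qed.

(** A valid cell has an unmarked entry, so the predecessor in the exponent of [alpha j] is not
    truncated and [k] simply adds to it. *)
Lemma cell_wt_max_tail i j n c e k : is_marked_mset c ->
  cell_wt i j (c ++ max_tail n e k) =
  cell_wt i j c * ((- b i * 'x_n) ^+ e * (a j * 'x_n) ^+ k).
Proof.
move=> /unmarked_gt0; rewrite /cell_wt /unmarked /marked !count_cat !count_nseq /=.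
case: (count _ c) => // u _; rewrite !mul0n !mul1n add0n addn0 addSn /=.
rewrite big_cat /max_tail big_cat /= !big_nseq_cond /= !iter_mulr_1.
rewrite !exprD !rmorphM !rmorphXn rmorphN /= !exprMn /a /b; ring.
Qed.

Lemma fps_sum_pure i j n :
  fps_sum [set c | exists k, c = nseq k.+1 (n, false)]%classic (cell_wt i j) =
  pole a j 'x_n.
Proof.
rewrite (@fps_sum_reindex _ _ _ _ setT (fun k => nseq k.+1 (n, false))).
  rewrite /pole -fps_geometric -fps_sum_mull; last exact: summable_geometric.
  by apply: eq_fps_sum => // k _; rewrite /= cell_wt_pure.
split; first by move=> k _; exists k.
  by move=> k k' _ _ /(congr1 size); rewrite /= !size_nseq => -[].
by move=> _ [k ->]; exists k.
Qed.

Lemma max_tail_inj n e k e' k' :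
  max_tail n e k = max_tail n e' k' -> (e, k) = (e', k').
Proof.
move=> E; have := congr1 marked E; have := congr1 unmarked E.
rewrite /unmarked /marked !count_cat !count_nseq /= !mul0n !mul1n !addn0 !add0n.
by move=> ->; case: e {E}; case: e'.
Qed.

(** The optional marked copy gives the numerator, and the free number of unmarked copies gives the
    geometric series. *)
Lemma fps_sum_max_tail i j n c : is_marked_mset c ->
  fps_sum [set d | exists e k, d = c ++ max_tail n e k]%classic (cell_wt i j) =
  cell_wt i j c * ((1 - b i * 'x_n) / (1 - a j * 'x_n)).
Proof.
move=> mc; have sb : summable [set: bool]%classic (fun e => (- b i * 'x_n) ^+ e).
  by move=> m; exists [:: true; false]; case.
have sg := summable_geometric (alpha j) n.
have sbg := summable_mul sb sg.
rewrite (@fps_sum_reindex _ _ _ _ ([set: bool] `*` setT)%classic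
   (fun p => c ++ max_tail n p.1 p.2)).
  transitivity (fps_sum ([set: bool] `*` setT)%classic
     (fun p => cell_wt i j c * ((- b i * 'x_n) ^+ p.1 * (a j * 'x_n) ^+ p.2))).
    by apply: eq_fps_sum => // p _; rewrite /= cell_wt_max_tail.
  rewrite (fps_sum_mull _ sbg) (fps_sum_mul sb sg) fps_geometric fps_sumT big_mkcond big_bool.
  by rewrite !asboolT//= expr0 expr1 addrC mulNr.
split; first by move=> -[e k] _; exists e, k.
  move=> -[e k] -[e' k'] _ _ /= /eqP; rewrite eqseq_cat// => /andP[_ /eqP].
  exact: max_tail_inj.
by move=> _ [e [k ->]]; exists (e, k).
Qed.

Definition fillings (la : seq nat) (C : nat -> nat -> set marked_mset) :=
  [set T | shape T = la /\
     forall i j, (j < nth 0%N la i)%N -> C i j (cell T i j)]%classic.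

Lemma fps_sum_fillings (la : seq nat) (C : nat -> nat -> set marked_mset) :
  summable (fillings la C) (wt alpha beta) /\
  fps_sum (fillings la C) (wt alpha beta) =
  \prod_(i < size la) \prod_(j < nth 0%N la i) fps_sum (C i j) (cell_wt i j).
Proof.
pose A i := [set r : seq marked_mset | size r = nth 0%N la i /\
  forall j, (j < nth 0%N la i)%N -> C i j (nth [::] r j)]%classic.
pose W i (r : seq marked_mset) :=
  \prod_(j < nth 0%N la i) cell_wt i j (nth [::] r j).
have rowP i : summable (A i) (W i) /\
    fps_sum (A i) (W i) = \prod_(j < nth 0%N la i) fps_sum (C i j) (cell_wt i j).
  exact: (@fps_sum_seq R _ [::] (nth 0%N la i) (C i) (cell_wt i)
    (fun j _ => @summable_cell_wt (C i j) i j)).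
have [sT ST] := @fps_sum_seq R _ [::] (size la) A W (fun i _ => proj1 (rowP i)).
have fillE T : fillings la C T <-> size T = size la /\
    forall i, (i < size la)%N -> A i (nth [::] T i).
  split=> [[sh CT]|[sz CT]].
    have sz : size T = size la by rewrite -sh size_map.
    split=> // i ila; split=> [|j]; last exact: CT.
    by rewrite -sh (nth_map [::])// sz.
  split=> [|i j].
    apply: (@eq_from_nth _ 0%N); rewrite size_map// sz => i ila.
    by rewrite (nth_map [::]) ?sz//; have [] := CT i ila.
  by case: (ltnP i (size la)) => ila; [have [_] := CT i ila; apply|rewrite nth_default].
have wtW T : fillings la C T ->
    wt alpha beta T = \prod_(i < size la) W i (nth [::] T i).
  move=> /fillE[sz CT]; rewrite wtE sz; apply: eq_bigr => i _.
  by have [-> _] := CT i (ltn_ord i).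
split.
  apply: eq_summable (summable_subset _ sT) => T; last by move/fillE.
  by move/wtW.
rewrite (eq_fps_sum fillE wtW) ST; apply: eq_bigr => i _.
by have [] := rowP i.
Qed.

End Weights.

(** * Removing the largest letter of a tableau *)

Section Truncation.
Variable n : nat.
Implicit Types (la mu : seq nat) (T U : filling).

Definition bounded_MMSVT k la :=
  [set T | is_MMSVT la T /\
     forall i j, all (fun a => a.1 < k)%N (cell T i j)]%classic.

(** Minima increase weakly along a row of a tableau, so the first cell without letters below [n]
    ends the part of the row that survives truncation. *)
Definition below_length T i := find (fun c => n <= cell_min c)%N (nth [::] T i).

(** Keeping [n] rows suffices: in partition shape, strict columns force letters of row [i] to be at
    least [i]. Surviving rows may be empty. *)
Definition below_filling T : filling :=
  mkseq (fun i => mkseq (fun j => below n (cell T i j)) (below_length T i)) n.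

(* The cells a tableau of shape [la] may have in position [(i, j)] when its
   letters smaller than [n] form the tableau [U] of shape [mu]. *)
Definition extension_cell la mu U i j : set marked_mset :=
  if (j < nth 0 mu i)%N then
    if (nth 0 la i.+1 <= j)%N && (j.+1 == nth 0 mu i)%N then
      [set c | exists e k, c = cell U i j ++ max_tail n e k]%classic
    else [set cell U i j]%classic
  else [set c | exists k, c = nseq k.+1 (n, false)]%classic.

Definition interlacing la mu :=
  forall i, (i < n)%N -> (nth 0 la i.+1 <= nth 0 mu i <= nth 0 la i)%N.

Lemma size_row la T i : shape T = la -> size (nth [::] T i) = nth 0%N la i.
Proof.
move=> <-; case: (ltnP i (size T)) => iT; first by rewrite (nth_map [::]).
by rewrite !nth_default ?size_map.
Qed.

Lemma cell_below_filling T i j : cell (below_filling T) i j =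
  if (i < n)%N && (j < below_length T i)%N then below n (cell T i j) else [::].
Proof.
rewrite {1}/cell; case: (ltnP i n) => ni; last first.
  by rewrite [nth [::] _ i]nth_default ?nth_nil// size_mkseq.
rewrite nth_mkseq//; case: ltnP => ji; first by rewrite nth_mkseq.
by rewrite nth_default// size_mkseq.
Qed.

Lemma shape_below_filling T :
  shape (below_filling T) = mkseq (below_length T) n.
Proof.
by rewrite /shape /below_filling /mkseq -map_comp; apply: eq_map => i /=;
  rewrite size_map size_iota.
Qed.

Section Restriction.
Variables (la : seq nat) (T : filling).
Hypothesis la_geq : forall i, (nth 0 la i.+1 <= nth 0 la i)%N.
Hypothesis TP : bounded_MMSVT n.+1 la T.
Let mT := proj1 TP.
Let bT := proj2 TP.

Lemma below_length_le i : (below_length T i <= nth 0 la i)%N.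
Proof. by rewrite -(size_row i (MMSVT_shape mT)) find_size. Qed.

Lemma cell_min_lt i j : (j < below_length T i)%N -> (cell_min (cell T i j) < n)%N.
Proof. by move=> /(before_find [::])/negbT; rewrite -ltnNge. Qed.

Lemma cell_min_ge i j : (below_length T i <= j)%N -> (j < nth 0 la i)%N ->
  (n <= cell_min (cell T i j))%N.
Proof.
move=> /subnKC <-; elim: (j - _)%N => [|d IH].
  rewrite addn0 -(size_row i (MMSVT_shape mT)) -has_find; exact: nth_find.
rewrite addnS => jla; apply: leq_trans (IH (ltnW jla)) _.
apply: leq_trans (MMSVT_row mT jla).
exact/cell_min_max/(MMSVT_cell mT)/ltnW.
Qed.

Lemma cell_max_lt i j : (j < nth 0 la i)%N -> (cell_max (cell T i j) < n.+1)%N.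
Proof.
move=> /(MMSVT_cell mT)/cell_max_mem[a aT ->]; exact: (allP (bT i j)).
Qed.

(** Columns are strict and no letter exceeds [n], so a cell with another one beneath it cannot
    contain [n]. *)
Lemma cell_max_lt_above i j : (j < nth 0 la i.+1)%N ->
  (cell_max (cell T i j) < n)%N.
Proof.
move=> jla; have jla' := leq_trans jla (la_geq i).
apply: leq_trans (MMSVT_col mT jla' jla) _.
rewrite -ltnS; apply: leq_ltn_trans (cell_min_max _) (cell_max_lt jla).
exact: (MMSVT_cell mT).
Qed.

Lemma below_length_ge i : (nth 0 la i.+1 <= below_length T i)%N.
Proof.
rewrite leqNgt; apply/negP => ilt; have ilt' := leq_trans ilt (la_geq i).
have := cell_max_lt_above ilt; rewrite ltnNge => /negP; apply.
apply: leq_trans (cell_min_ge (leqnn _) ilt') (cell_min_max _).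
exact: (MMSVT_cell mT).
Qed.

Lemma row_le_cell_min i j : (j < nth 0 la i)%N -> (i <= cell_min (cell T i j))%N.
Proof.
elim: i => // i IH jla; have jla' := leq_trans jla (la_geq i).
apply: leq_ltn_trans (MMSVT_col mT jla' jla).
apply: leq_trans (IH jla') (cell_min_max _); exact: (MMSVT_cell mT).
Qed.

Lemma below_length0 i : (n <= i)%N -> below_length T i = 0%N.
Proof.
move=> ni; apply/eqP; rewrite -leqn0 leqNgt; apply/negP => i0.
have := cell_min_lt i0; rewrite ltnNge => /negP; apply.
by apply: leq_trans ni (row_le_cell_min _); apply: leq_trans i0 (below_length_le i).
Qed.

Lemma nth_below_length i :
  nth 0%N (mkseq (below_length T) n) i = below_length T i.
Proof.
case: (ltnP i n) => ni; first by rewrite nth_mkseq.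
by rewrite nth_default ?size_mkseq// below_length0.
Qed.

Lemma interlacing_below_length : interlacing la (mkseq (below_length T) n).
Proof.
by move=> i ni; rewrite nth_below_length below_length_ge below_length_le.
Qed.

Lemma below_filling_MMSVT :
  bounded_MMSVT n (mkseq (below_length T) n) (below_filling T).
Proof.
have cellE i j : (j < nth 0 (mkseq (below_length T) n) i)%N ->
    [/\ cell (below_filling T) i j = below n (cell T i j), (j < nth 0 la i)%N,
        is_marked_mset (cell T i j) & (cell_min (cell T i j) < n)%N].
  rewrite nth_below_length => jl.
  have jla := leq_trans jl (below_length_le i).
  rewrite cell_below_filling jl andbT; case: ltnP => [_|ni].
    by split=> //; [apply: (MMSVT_cell mT)|apply: cell_min_lt].
  by rewrite below_length0 in jl.
split; last first.
  move=> i j; rewrite cell_below_filling; case: ifP => // _.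
  by apply/allP => a; rewrite mem_filter => /andP[].
split.
- exact: shape_below_filling.
- by move=> i j /cellE[-> _ mc cn]; have [] := marked_mset_below mc cn.
- move=> i j jS; have [-> jla mc cn] := cellE _ _ jS.
  have [-> _ mc' cn'] := cellE _ _ (ltnW jS).
  have [_ -> _ _] := marked_mset_below mc cn.
  have [_ _ le _] := marked_mset_below mc' cn'.
  exact: leq_trans le (MMSVT_row mT jla).
- move=> i j jS jS'; have [-> jla' mc' cn'] := cellE _ _ jS.
  have [-> jla mc cn] := cellE _ _ jS'.
  have [_ -> _ _] := marked_mset_below mc cn.
  have [_ _ le _] := marked_mset_below mc' cn'.
  exact: leq_ltn_trans le (MMSVT_col mT jla' jla).
Qed.

(** A cell of the truncated shape can have lost letters [n] only if nothing lies below it in [la]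
    and it ends its truncated row: a right neighbour with minimum below [n] also excludes [n]. *)
Lemma extension_below_filling :
  fillings la (extension_cell la (mkseq (below_length T) n) (below_filling T)) T.
Proof.
split=> [|i j jla]; first exact: MMSVT_shape mT.
rewrite /extension_cell nth_below_length; have mc := MMSVT_cell mT jla.
case: ltnP => jl; last exact: marked_mset_pure mc (cell_min_ge jl jla) (bT i j).
have ni : (i < n)%N.
  by rewrite ltnNge; apply/negP => /below_length0 i0; rewrite i0 in jl.
rewrite cell_below_filling ni jl /=; case: ifPn => [_|].
  exact: marked_mset_split mc (cell_min_lt jl) (bT i j).
rewrite negb_and -ltnNge /= => jP; rewrite below_id//.
case/orP: jP => [|jS]; first exact: cell_max_lt_above.
have jS' : (j.+1 < below_length T i)%N by rewrite ltn_neqAle jS.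
apply: leq_ltn_trans (cell_min_lt jS').
exact: (MMSVT_row mT (leq_trans jS' (below_length_le i))).
Qed.

End Restriction.

Section Extension.
Variables (la mu : seq nat) (T U : filling).
Hypotheses (la_size : size la = n.+1) (mu_size : size mu = n).
Hypothesis il : interlacing la mu.
Hypothesis UP : bounded_MMSVT n mu U.
Hypothesis TP : fillings la (extension_cell la mu U) T.
Let mU := proj1 UP.
Let bU := proj2 UP.

Lemma extension_cellP i j : (j < nth 0 la i)%N ->
  [/\ is_marked_mset (cell T i j), all (fun a => a.1 < n.+1)%N (cell T i j) &
    if (j < nth 0 mu i)%N then
      [/\ cell_min (cell T i j) = cell_min (cell U i j),
        (cell_min (cell T i j) < n)%N,
        below n (cell T i j) = cell U i j &
        ((j < nth 0 la i.+1) || (j.+1 < nth 0 mu i))%N -> cell T i j = cell U i j]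
    else cell_min (cell T i j) = n].
Proof.
move=> /(proj2 TP i j); rewrite /extension_cell; case: ltnP => jmu; last first.
  by move=> [k ->]; have [] := marked_mset_nseq n k.
have mc := MMSVT_cell mU jmu.
have cn : (cell_max (cell U i j) < n)%N.
  by have [a aU ->] := cell_max_mem mc; apply: (allP (bU i j)).
have cn' := leq_ltn_trans (cell_min_max mc) cn.
case: ifPn => [/andP[laj /eqP jmu']|_].
  move=> [e [k ->]]; have [? -> ? ?] := marked_mset_max_tail e k mc cn.
  by split=> //; split=> //; rewrite -jmu' ltnn orbF ltnNge laj.
move=> /= ->; split=> //; last by split=> //; rewrite below_id.
by apply: sub_all (bU i j) => a /ltnW.
Qed.

Lemma extension_MMSVT : bounded_MMSVT n.+1 la T.
Proof.
have maxn i j : (j < nth 0 la i)%N -> (cell_max (cell T i j) <= n)%N.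
  move=> /extension_cellP[mc bc _]; have [a aT ->] := cell_max_mem mc.
  exact: (allP bc).
have shT := proj1 TP; split; last first.
  move=> i j; case: (ltnP j (nth 0%N la i)) => [/extension_cellP[]//|].
  by rewrite -(size_row i shT) => /(nth_default [::]) jT; rewrite /cell jT.
split=> //.
- by move=> i j /extension_cellP[].
(* If the right neighbour is old, this cell is not the last old one and is unchanged; if it is new,
   its minimum is [n]. *)
- move=> i j jS; have [_ _] := extension_cellP jS.
  case: ifP => [jmu [-> _ _ _]|_ ->]; last exact: maxn (ltnW jS).
  have [_ _] := extension_cellP (ltnW jS); rewrite (ltnW jmu) jmu orbT.
  by move=> -[_ _ _ ->//]; apply: (MMSVT_row mU).
move=> i j jla jla'; have ni : (i < n)%N.
  rewrite ltnNge; apply/negP => ni; move: jla'.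
  by rewrite nth_default// la_size.
(* By interlacing, a cell with another one below it lies in [mu], and it received no tail. *)
have jmu : (j < nth 0 mu i)%N by have /andP[/(leq_trans jla')] := il ni.
have [_ _] := extension_cellP jla; rewrite jmu jla' => -[_ cn _ cE].
have cUE := cE isT; have [_ _] := extension_cellP jla'; case: ifP => [jmu' [-> _ _ _]|_ ->].
  by rewrite cUE; apply: (MMSVT_col mU jmu jmu').
have [a aU] := cell_max_mem (MMSVT_cell mU jmu).
by rewrite cUE => ->; apply: (allP (bU i j)).
Qed.

(** Minima tell old cells from new ones: they are below [n] on the former and equal to [n] on the
    latter. *)
Lemma extension_below_length i : (i < n)%N -> below_length T i = nth 0%N mu i.
Proof.
move=> ni; have /andP[_ mula] := il ni.
have bT := below_length_le extension_MMSVT i.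
case: (ltngtP (below_length T i) (nth 0%N mu i)) => // lt.
  have [_ _] := extension_cellP (leq_trans lt mula); rewrite lt => -[_ + _ _].
  rewrite ltnNge => /negP[]; apply: (cell_min_ge extension_MMSVT) => //.
  exact: leq_trans lt mula.
have := cell_min_lt lt.
have [_ _] := extension_cellP (leq_trans lt bT).
by rewrite ltnn => ->; rewrite ltnn.
Qed.

Lemma extension_below_filling_eq : below_filling T = U.
Proof.
have shU := MMSVT_shape mU; have szU : size U = n by rewrite -mu_size -shU size_map.
apply: (@eq_from_nth _ [::]); rewrite size_mkseq ?szU// => i ni.
rewrite nth_mkseq//; apply: (@eq_from_nth _ [::]).
  by rewrite size_mkseq (size_row i shU) extension_below_length.
move=> j; rewrite size_mkseq => jl; rewrite nth_mkseq//.
rewrite extension_below_length// in jl; have /andP[_ mula] := il ni.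
have [_ _] := extension_cellP (leq_trans jl mula).
by rewrite jl => -[].
Qed.

End Extension.
End Truncation.

(** * The branching rule for tableaux and the induction on the number of variables *)

Section Main.
Variables (R : comNzRingType) (alpha beta : nat -> R).
Implicit Types (la mu : seq nat) (T U : filling).

Let a k : fps R := fpsC (alpha k).
Let b k : fps R := fpsC (beta k).

Lemma fps_sum_extension_cell n la mu U i j : bounded_MMSVT n mu U ->
  fps_sum (extension_cell n la mu U i j) (cell_wt alpha beta i j) =
  if (j < nth 0 mu i)%N then
    cell_wt alpha beta i j (cell U i j) *
    (if (nth 0 la i.+1 <= j)%N && (j.+1 == nth 0 mu i)%N
     then (1 - b i * 'x_n) / (1 - a j * 'x_n) else 1)
  else pole a j 'x_n.
Proof.
move=> [mU _]; rewrite /extension_cell; case: ifPn => jmu; last exact: fps_sum_pure.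
case: ifPn => _; last by rewrite fps_sum1 mulr1.
exact/fps_sum_max_tail/(MMSVT_cell mU).
Qed.

Lemma fps_sum_extension_row n la mu U i : bounded_MMSVT n mu U ->
  (nth 0 la i.+1 <= nth 0 mu i <= nth 0 la i)%N ->
  \prod_(j < nth 0%N la i)
    fps_sum (extension_cell n la mu U i j) (cell_wt alpha beta i j) =
  (\prod_(j < nth 0%N mu i) cell_wt alpha beta i j (cell U i j)) *
  branch_wt a b i (nth 0%N la i.+1) (nth 0%N la i) 'x_n (nth 0%N mu i).
Proof.
move=> UP /andP[lamu mula].
rewrite -(big_mkord xpredT (fun j =>
  fps_sum (extension_cell n la mu U i j) (cell_wt alpha beta i j))).
rewrite (big_cat_nat (leq0n _) mula)/=.
rewrite [X in _ * X](eq_big_nat _ _ (F2 := fun j => pole a j 'x_n)); last first.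
  by move=> j /andP[muj _]; rewrite fps_sum_extension_cell// ltnNge muj.
rewrite /branch_wt [RHS]mulrCA [LHS]mulrC; congr (_ * _).
rewrite big_mkord (eq_bigr (fun j : 'I_(nth 0%N mu i) =>
    cell_wt alpha beta i j (cell U i j) *
    (if (nth 0 la i.+1 <= j)%N && (j.+1 == nth 0 mu i)%N
     then (1 - b i * 'x_n) / (1 - a j * 'x_n) else 1))); last first.
  by move=> j _; rewrite fps_sum_extension_cell// ltn_ord.
rewrite big_split/=; congr (_ * _).
(* An empty old row has no cell to extend. Otherwise only its last cell, in column [m], can carry a
   tail, and the test [<= m] on that cell is the strict test against [m.+1] in [branch_wt]. *)
move: (nth 0%N mu i) lamu {mula UP} => [|m] lamu.
  by rewrite big_ord0 ltn0.
rewrite big_ord_recr/= eqxx andbT ltnS big1 ?mul1r// => j _.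
by rewrite eqSS ltn_eqF ?andbF.
Qed.

Lemma fps_sum_extension n la mu U : bounded_MMSVT n mu U -> size mu = n ->
  size la = n.+1 -> interlacing n la mu ->
  fps_sum (fillings la (extension_cell n la mu U)) (wt alpha beta) =
  (\prod_(0 <= l < nth 0%N la n) pole a l 'x_n) *
  (\prod_(i < n)
     branch_wt a b i (nth 0%N la i.+1) (nth 0%N la i) 'x_n (nth 0%N mu i)) *
  wt alpha beta U.
Proof.
move=> UP szmu szla il; have shU := MMSVT_shape (proj1 UP).
have [_ ->] := fps_sum_fillings alpha beta la (extension_cell n la mu U).
(* The bottom row [n] has no old cell, as [nth 0 mu n] is the default 0; it accounts for the
   separate product of poles. *)
rewrite szla big_ord_recr/= fps_sum_extension_row//; last first.
  by rewrite [nth 0%N la _]nth_default ?szla// [nth 0%N mu n]nth_default ?szmu.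
rewrite (eq_bigr (fun i : 'I_n =>
    (\prod_(j < nth 0%N mu i) cell_wt alpha beta i j (cell U i j)) *
    branch_wt a b i (nth 0%N la i.+1) (nth 0%N la i) 'x_n (nth 0%N mu i))).
  rewrite big_split/= [nth 0%N mu n]nth_default ?szmu// big_ord0.
  have -> : wt alpha beta U =
      \prod_(i < n) \prod_(j < nth 0%N mu i) cell_wt alpha beta i j (cell U i j).
    rewrite wtE -(size_map size U) -/(shape U) shU szmu.
    by apply: eq_bigr => i _; rewrite (size_row i shU).
  rewrite /(branch_wt _ _ n _ _ _ 0) ltn0; ring.
by move=> i _; apply: fps_sum_extension_row => //; apply: il.
Qed.

(** Encoding the smaller shapes by a finite type makes the sum over them the one that [det_row_sum]
    produces. *)
Definition ffun_seq n N (f : {ffun 'I_n -> 'I_N.+1}) : seq nat :=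
  [seq val (f i) | i <- enum 'I_n].

Lemma nth_ffun_seq n N (f : {ffun 'I_n -> 'I_N.+1}) (i : 'I_n) :
  nth 0%N (ffun_seq f) i = f i.
Proof. by rewrite (nth_map i) ?size_enum_ord// nth_ord_enum. Qed.

Lemma size_ffun_seq n N (f : {ffun 'I_n -> 'I_N.+1}) : size (ffun_seq f) = n.
Proof. by rewrite size_map size_enum_ord. Qed.

(** Tableaux form a subset of the fillings with arbitrary cells, which are already summable. *)
Lemma summable_MMSVT n la : summable (bounded_MMSVT n la) (wt alpha beta).
Proof.
have [+ _] := fps_sum_fillings alpha beta la (fun _ _ => setT).
by apply: summable_subset => T [mT _]; split=> //; apply: MMSVT_shape mT.
Qed.

Lemma fps_sum_branch n N la : size la = n.+1 ->
  (forall i, (nth 0 la i.+1 <= nth 0 la i)%N) ->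
  (forall i, (nth 0 la i <= N)%N) ->
  fps_sum (bounded_MMSVT n.+1 la) (wt alpha beta) =
  (\prod_(0 <= l < nth 0%N la n) pole a l 'x_n) *
  \sum_(f : {ffun 'I_n -> 'I_N.+1} |
      [forall i : 'I_n, nth 0 la i.+1 <= f i <= nth 0 la i]%N)
    (\prod_(i < n) branch_wt a b i (nth 0%N la i.+1) (nth 0%N la i) 'x_n (f i)) *
    fps_sum (bounded_MMSVT n (ffun_seq f)) (wt alpha beta).
Proof.
move=> szla la_geq laN; set A := bounded_MMSVT n.+1 la.
have ilP (f : {ffun 'I_n -> 'I_N.+1}) :
    [forall i : 'I_n, nth 0 la i.+1 <= f i <= nth 0 la i]%N <->
    interlacing n la (ffun_seq f).
  split=> [/forallP fP i ni|il]; last apply/forallP => i.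
    by have := fP (Ordinal ni); rewrite -(nth_ffun_seq f (Ordinal ni)).
  by rewrite -nth_ffun_seq; apply: il.
(* On [A], [inord] loses nothing: the truncated row is no longer than the part of [la], which is at
   most [N]. *)
pose p T : {ffun 'I_n -> 'I_N.+1} := [ffun i : 'I_n => inord (below_length n T i)].
have pE T : A T -> ffun_seq (p T) = mkseq (below_length n T) n.
  move=> TP; apply: (@eq_from_nth _ 0%N); rewrite size_ffun_seq ?size_mkseq// => i ni.
  rewrite (nth_ffun_seq _ (Ordinal ni)) ffunE nth_mkseq// inordK//.
  by rewrite ltnS (leq_trans (below_length_le TP _)).
(* The tableaux are grouped first by the shape of their truncation, then, below, by the truncation
   itself. *)
rewrite (@fps_sum_fiber _ _ _ _
  [set f : {ffun 'I_n -> 'I_N.+1} | interlacing n la (ffun_seq f)]%classic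
  (fun f => [set T | A T /\ p T = f]%classic) p).
- rewrite fps_sumT mulr_sumr; apply: eq_big => [f|f /asboolP fP].
    by rewrite (asbool_equiv_eq (iff_sym (ilP f))) asboolb.
  rewrite (@fps_sum_fiber _ _ _ _ (bounded_MMSVT n (ffun_seq f))
    (fun U => fillings la (extension_cell n la (ffun_seq f) U)) (below_filling n)).
  + rewrite mulrA -fps_sum_mull; last exact: summable_MMSVT.
    apply: eq_fps_sum => // U UP.
    rewrite fps_sum_extension ?size_ffun_seq//; congr (_ * _ * _).
    by apply: eq_bigr => i _; rewrite nth_ffun_seq.
  + by apply: summable_subset (@summable_MMSVT n.+1 la) => T [].
  + move=> T [TP pT]; rewrite -pT pE//.
    by split; [exact: below_filling_MMSVT TP|exact: extension_below_filling TP].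
  + move=> U T UP TP; split; last first.
      by apply: extension_below_filling_eq UP TP; rewrite ?size_ffun_seq.
    have AT : A T by apply: extension_MMSVT UP TP; rewrite ?size_ffun_seq.
    split=> //; apply/ffunP => i; apply/val_inj; rewrite /= -(nth_ffun_seq (p T)) pE// nth_mkseq//.
    rewrite -nth_ffun_seq.
    by apply: extension_below_length UP TP _ _; rewrite ?size_ffun_seq.
- exact: summable_MMSVT.
- by move=> T TP; split=> //=; rewrite pE//; apply: interlacing_below_length TP.
- by move=> f T _ [].
Qed.

Lemma pole_prod k (y : fps R) : (forall l, 1 - a l * y \is a GRing.unit) ->
  \prod_(0 <= l < k) pole a l y = y ^+ k / \prod_(l < k) (1 - a l * y).
Proof.
move=> uy; rewrite big_mkord big_split/= prodr_const card_ord; congr (_ * _).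
by rewrite prodrV.
Qed.

Lemma grothendieck_mxE la n : grothendieck_mx alpha beta la n =
  \matrix_(i < n, j < n) row_entry a b n i (nth 0%N la i) 'x_j.
Proof.
apply/matrixP => i j; rewrite !mxE /row_entry pole_prod; last first.
  by move=> l; apply: one_subCX_unit.
rewrite -addnBA// exprD -!mulrA mulrCA; congr (_ * _).
by rewrite mulrCA.
Qed.

(** The factors ['x_j - 'x_n] of the larger Vandermonde product are those produced by [det_branch];
    the two sums over [f] then agree term by term by induction. *)
Lemma fps_sum_MMSVT_det n la : size la = n ->
  (forall i, (nth 0 la i.+1 <= nth 0 la i)%N) ->
  fps_sum (bounded_MMSVT n la) (wt alpha beta) * vandermonde R n =
  \det (\matrix_(i < n, j < n) row_entry a b n i (nth 0%N la i) 'x_j).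
Proof.
elim: n la => [|n IH] la szla la_geq.
  rewrite det_mx00 /vandermonde big_ord0 mulr1 (size0nil szla).
  rewrite (@eq_fps_sum _ _ _ [set [::]]%classic _ (wt alpha beta)) ?fps_sum1//.
    by rewrite wtE big_ord0.
  move=> T; split=> [[mT _]|->].
    by have := MMSVT_shape mT; case: T {mT}.
  by split; [split=> // i j; rewrite nth_nil|move=> i j; rewrite /cell !nth_nil].
pose N := nth 0%N la 0.
have laN i : (nth 0 la i <= N)%N by elim: i => // i; apply: leq_trans.
rewrite det_branch//; last 2 first.
- by move=> k j; apply: one_subCX_unit.
- by move=> k j; apply: one_subCX_unit.
(* The interval sums, whose bounds depend on the row, become conditional sums over one finite type,
   as [det_row_sum] requires. *)
have -> : (\matrix_(i < n, j < n) branch_row a b (nth 0%N la) n i 'x_n 'x_j) =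
    \matrix_(i < n, j < n) \sum_(k : 'I_N.+1 | (nth 0 la i.+1 <= k <= nth 0 la i)%N)
      branch_wt a b i (nth 0%N la i.+1) (nth 0%N la i) 'x_n k *
      row_entry a b n i k 'x_j.
  apply/matrixP => i j; rewrite !mxE /branch_row.
  rewrite (big_nat_widen _ _ N.+1) ?ltnS// (big_nat_widenl _ 0%N)// big_mkord.
  by apply: eq_bigl => k; rewrite ltnS andbC.
rewrite det_row_sum (fps_sum_branch szla la_geq laN).
have -> : vandermonde R n.+1 = (\prod_(j < n) ('x_j - 'x_n)) * vandermonde R n.
  rewrite /vandermonde big_ord_recr/= [X in _ * X]big_pred0 ?mulr1.
    rewrite -big_split/=; apply: eq_bigr => i _.
    rewrite big_mkcond big_ord_recr/= ltn_ord mulrC -big_mkcond.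
    by [].
  by move=> j; rewrite ltnNge -ltnS ltn_ord.
rewrite mulrCA -!mulrA; congr (_ * (_ * _)).
rewrite mulr_suml; apply: eq_bigr => f fP; rewrite -mulrA IH ?size_ffun_seq//.
  congr (_ * \det _); apply/matrixP => i j; by rewrite !mxE nth_ffun_seq.
(* The interlacing shape is again weakly decreasing, because a part of [la] lies between any two
   consecutive parts of it. *)
move=> i; case: (ltnP i.+1 n) => ni; last by rewrite nth_default// size_ffun_seq.
rewrite (nth_ffun_seq f (Ordinal ni)) (nth_ffun_seq f (Ordinal (ltnW ni))).
have /andP[_ le] := forallP fP (Ordinal ni).
by have /andP[+ _] := forallP fP (Ordinal (ltnW ni)); apply: leq_trans.
Qed.

End Main.

(** * Specialization of the tableau sum, and padding by empty rows *)

Lemma nth_cat_nseq (T : Type) (x0 : T) (s : seq T) k i :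
  nth x0 (s ++ nseq k x0) i = nth x0 s i.
Proof.
by rewrite nth_cat nth_nseq if_same; case: ltnP => // /(nth_default x0) ->.
Qed.

Section Specialization.
Variables (R : comNzRingType) (alpha beta : nat -> R) (n : nat).
Implicit Types (la : seq nat) (T : filling).

Lemma fps_restrict_cell_wt i j (c : marked_mset) :
  fps_restrict n (cell_wt alpha beta i j c) =
  if all (fun a => a.1 < n)%N c then cell_wt alpha beta i j c else 0.
Proof.
rewrite /cell_wt fps_restrictM fps_restrictC fps_restrict_prod.
rewrite (eq_bigr (fun a => if (a.1 < n)%N then 'x_(a.1) else 0)); last first.
  by move=> a _; rewrite fps_restrictX.
case: ifPn => [cn|/allPn[a ac an]].
  by congr (_ * _); apply: eq_big_seq => a /(allP cn) ->.
by rewrite (big_rem a)//= (negPf an) !mul0r.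
Qed.

Lemma fps_restrict_wt T :
  ((forall i j, all (fun a => a.1 < n)%N (cell T i j)) ->
    fps_restrict n (wt alpha beta T) = wt alpha beta T) /\
  (~ (forall i j, all (fun a => a.1 < n)%N (cell T i j)) ->
    fps_restrict n (wt alpha beta T) = 0).
Proof.
rewrite wtE fps_restrict_prod; split=> [bT|].
  apply: eq_bigr => i _; rewrite fps_restrict_prod; apply: eq_bigr => j _.
  by rewrite fps_restrict_cell_wt bT.
move=> /existsNP[i /existsNP[j /negP nT]].
have jT : (j < size (nth [::] T i))%N.
  by rewrite ltnNge; apply: contra nT => jT; rewrite /cell nth_default.
have iT : (i < size T)%N.
  by rewrite ltnNge; apply: contraTN jT => iT; rewrite [nth _ _ i]nth_default.
rewrite (bigD1 (Ordinal iT))//= fps_restrict_prod (bigD1 (Ordinal jT))//=.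
by rewrite fps_restrict_cell_wt (negPf nT) !mul0r.
Qed.

(** Setting the variables from index [n] on to zero kills exactly the contributions of tableaux with
    a letter at least [n] and fixes all others. *)
Lemma fps_restrict_MMSVT la :
  fps_restrict n (fps_sum (MMSVT la) (wt alpha beta)) =
  fps_sum (bounded_MMSVT n la) (wt alpha beta).
Proof.
rewrite fps_restrict_sum.
transitivity (fps_sum (bounded_MMSVT n la)
    (fun T => fps_restrict n (wt alpha beta T))); last first.
  by apply: eq_fps_sum => // T [_ bT]; apply: (proj1 (fps_restrict_wt T)).
apply/fpsP => m; symmetry; apply: fsbig_widen => [T []//|T [mT nT]].
change (fps_restrict n (wt alpha beta T) m = 0).
by rewrite (proj2 (fps_restrict_wt T))// => bT; apply: nT.
Qed.

(** [shape] records empty rows, so the two sets of fillings differ; appending [k] empty rows is a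
    bijection that preserves weights. *)
Lemma fps_sum_MMSVT_pad la k :
  fps_sum (bounded_MMSVT n (la ++ nseq k 0%N)) (wt alpha beta) =
  fps_sum (bounded_MMSVT n la) (wt alpha beta).
Proof.
have cell_pad T i j : cell (T ++ nseq k [::]) i j = cell T i j.
  by rewrite /cell nth_cat_nseq.
have padP T : shape T = la ->
    bounded_MMSVT n la T <-> bounded_MMSVT n (la ++ nseq k 0%N) (T ++ nseq k [::]).
  move=> shT; split=> -[[sh mc mr ml] bT]; split; try split.
  - by rewrite /shape map_cat map_nseq -/(shape T) shT.
  - by move=> i j; rewrite nth_cat_nseq cell_pad; apply: mc.
  - by move=> i j; rewrite nth_cat_nseq !cell_pad; apply: mr.
  - by move=> i j; rewrite !nth_cat_nseq !cell_pad; apply: ml.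
  - by move=> i j; rewrite cell_pad.
  - by [].
  - by move=> i j; have := mc i j; rewrite nth_cat_nseq cell_pad.
  - by move=> i j; have := mr i j; rewrite nth_cat_nseq !cell_pad.
  - by move=> i j; have := ml i j; rewrite !nth_cat_nseq !cell_pad.
  - by move=> i j; have := bT i j; rewrite cell_pad.
rewrite (@fps_sum_reindex _ _ _ _ (bounded_MMSVT n la) (fun T => T ++ nseq k [::])).
  apply: eq_fps_sum => // T _ /=; rewrite !wtE size_cat size_nseq.
  rewrite big_split_ord/= [X in _ * X]big1 ?mulr1; last first.
    by move=> i _; rewrite nth_cat_nseq nth_default ?leq_addr//= big_ord0.
  apply: eq_bigr => i _; rewrite nth_cat_nseq; apply: eq_bigr => j _.
  by rewrite cell_pad.
split.
- by move=> T TP; apply/padP => //; apply: MMSVT_shape (proj1 TP).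
- move=> T T' _ _ /= E; have := congr1 size E; rewrite !size_cat => /eqP.
  by rewrite eqn_add2r => /eqP sT; move/eqP: E; rewrite eqseq_cat// => /andP[/eqP].
move=> T TP; have shT := MMSVT_shape (proj1 TP).
have szT : size T = (size la + k)%N by rewrite -(size_map size) -/(shape T) shT size_cat size_nseq.
(* The rows after the first [size la] have length 0, hence are the appended ones. *)
have TE : take (size la) T ++ nseq k [::] = T.
  rewrite -[RHS](cat_take_drop (size la)); congr (_ ++ _).
  have kE : size (drop (size la) T) = k by rewrite size_drop szT addKn.
  apply: (@eq_from_nth _ [::]); rewrite size_nseq ?kE// => i ik.
  rewrite nth_nseq ik nth_drop; apply/esym/size0nil.
  by rewrite (size_row _ shT) nth_cat_nseq nth_default ?leq_addr.
exists (take (size la) T) => //; apply/padP; last by rewrite TE.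
by rewrite /shape map_take -/(shape T) shT take_size_cat.
Qed.

End Specialization.

(** * Identification with the determinantal power series *)

Lemma is_grothendieck_MMSVT (R : comNzRingType) (alpha beta : nat -> R) la :
  is_partition la ->
  is_grothendieck alpha beta la (fps_sum (MMSVT la) (wt alpha beta)).
Proof.
move=> /andP[/(sortedP 0%N) la_sorted _] n lan.
rewrite fps_restrict_MMSVT -(fps_sum_MMSVT_pad _ _ _ _ (n - size la)).
rewrite fps_sum_MMSVT_det ?size_cat ?size_nseq ?subnKC//.
  by rewrite grothendieck_mxE; congr (\det _); apply/matrixP => i j; rewrite !mxE nth_cat_nseq.
move=> i; rewrite !nth_cat_nseq; case: (ltnP i.+1 (size la)) => [/la_sorted//|iS].
by rewrite nth_default.
Qed.

Theorem theorem6p2 (R : comNzRingType) (alpha beta : nat -> R) (la : seq nat) :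
  is_partition la ->
  grothendieck alpha beta la = fps_sum (MMSVT la) (wt alpha beta).
Proof.
move=> laP; have gP := is_grothendieck_MMSVT alpha beta laP.
(* [grothendieck] is a chosen solution of its specialization property. The tableau sum is one by
   [gP]; any other agrees with it after each restriction to at least [size la] variables, once the
   Vandermonde product is cancelled. *)
apply: xget_unique => // g hP; apply: fps_restrict_inj.
exists (size la) => n lan; apply/eqP; rewrite -subr_eq0; apply/eqP.
apply: (@vandermonde_regular R n).
by rewrite mulrBl (hP n lan) (gP n lan) subrr.
Qed.
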